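(* Let $R$ be a complete local ring, $\mathfrak{a}$ a proper ideal, $\overline R:=R/\mathfrak a$, and let $\Lambda$ be a Noetherian $R$-algebra with $\mathrm{Tor}_i^R(\Lambda,\overline R)=0$ for all $i>0$. Set $\overline\Lambda:=\Lambda/\mathfrak a\Lambda$. Assume that $R$ is normally flat along the ideal $\mathfrak a$. Then $$\mathrm{Tor}^R_i(\Lambda,R/\mathfrak a^n)=0\quad\text{for all integers } i>0 \text{ and } n>0.$$ Moreover, any complex $P\in D^-(\mathrm{mod}\,\overline\Lambda)$ satisfying $\mathrm{Hom}_{D(\overline\Lambda)}(P,P[2])=0$ has a lift $L\in D^-(\mathrm{mod}\,\Lambda)$.
   Context: Modules are right modules. A complete local ring means a commutative Noetherian local ring complete with respect to its maximal ideal. A Noetherian $R$-algebra is an $R$-algebra (with $R$ mapping to the center) which is finitely generated as a module over the commutative Noetherian ring $R$. $R$ is normally flat along $\mathfrak a$ if $\mathfrak a^n/\mathfrak a^{n+1}$ is flat as an $R/\mathfrak a$-module for every integer $n>0$. A lift of $P\in D^-(\mathrm{mod}\,\overline\Lambda)$ is a complex $L\in D^-(\mathrm{mod}\,\Lambda)$ with $L\otimes^{\mathbb L}_\Lambda\overline\Lambda\cong P$ in $D^-(\mathrm{mod}\,\overline\Lambda)$. $\mathrm{mod}\,A$ denotes finitely generated $A$-modules. *)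

(* Defs.v *)
Set Warnings "-redundant-canonical-projection,-projection-no-head-constant,-notation-overridden,-ambiguous-paths".
From HB Require Import structures.
From mathcomp Require Import all_boot all_order all_algebra.
From mathcomp Require Import boolp.

Set Implicit Arguments.
Unset Strict Implicit.
Unset Printing Implicit Defensive.

Import GRing.Theory.
Local Open Scope ring_scope.
Local Open Scope quotient_scope.

(* Two-sided, not necessarily proper.                                         *)
Record ideal (A : pzRingType) := Ideal {
  ideal_mem :> {pred A};
  ideal_zmod_closed : zmod_closed ideal_mem;
  ideal_Ml : forall c, {in ideal_mem, forall x, c * x \in ideal_mem};
  ideal_Mr : forall c, {in ideal_mem, forall x, x * c \in ideal_mem}
}.

HB.instance Definition _ (A : pzRingType) (I : ideal A) :=
  GRing.isZmodClosed.Build A (ideal_mem I) (ideal_zmod_closed I).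

(* The library's quotients {quot I}, {ideal_quot I} have a ring structure     *)
(* only for proper ideals of commutative rings.                               *)
Definition quotring (A : pzRingType) (I : ideal A) : Type :=
  Quotient.quot (ideal_mem I).

Section QuotientRing.
Variables (A : pzRingType) (I : ideal A).

HB.instance Definition _ := GRing.Zmodule.on (quotring I).

Definition qproj (x : A) : quotring I := \pi_(Quotient.quot (ideal_mem I)) x.
Definition qrepr (x : quotring I) : A :=
  repr (x : Quotient.quot (ideal_mem I)).

Lemma qreprK : cancel qrepr qproj. Proof. exact: reprK. Qed.

Lemma qproj_eq x y : qproj x = qproj y <-> x - y \in ideal_mem I.
Proof.
by rewrite Quotient.idealrBE; split=> [/eqP|/eqP].
Qed.

Lemma qproj_zmod : zmod_morphism qproj.
Proof. by move=> x y; rewrite /qproj raddfB. Qed.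
HB.instance Definition _ :=
  GRing.isZmodMorphism.Build A (quotring I) qproj qproj_zmod.

Lemma qproj_repr x : x - qrepr (qproj x) \in ideal_mem I.
Proof. by apply/qproj_eq; rewrite qreprK. Qed.

Definition qmul (x y : quotring I) : quotring I := qproj (qrepr x * qrepr y).

Lemma qprojM x y : qproj (x * y) = qmul (qproj x) (qproj y).
Proof.
apply/qproj_eq; set x' := qrepr _; set y' := qrepr _.
rewrite -(subrK (x * y') (x * y)) -mulrBr -addrA -mulrBl rpredD //.
- exact/ideal_Ml/qproj_repr.
- exact/ideal_Mr/qproj_repr.
Qed.

Lemma qmulA : associative qmul.
Proof.
move=> x y z; rewrite -[x]qreprK -[y]qreprK -[z]qreprK.
by rewrite -!qprojM mulrA.
Qed.
Lemma qmul1 : left_id (qproj 1) qmul.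
Proof. by move=> x; rewrite -[x]qreprK -qprojM mul1r. Qed.
Lemma qmulr1 : right_id (qproj 1) qmul.
Proof. by move=> x; rewrite -[x]qreprK -qprojM mulr1. Qed.
Lemma qmulDl : left_distributive qmul +%R.
Proof.
move=> x y z; rewrite -[x]qreprK -[y]qreprK -[z]qreprK.
by rewrite -raddfD -!qprojM mulrDl raddfD.
Qed.
Lemma qmulDr : right_distributive qmul +%R.
Proof.
move=> x y z; rewrite -[x]qreprK -[y]qreprK -[z]qreprK.
by rewrite -raddfD -!qprojM mulrDr raddfD.
Qed.

HB.instance Definition _ := GRing.Zmodule_isPzRing.Build (quotring I)
  qmulA qmul1 qmulr1 qmulDl qmulDr.

Lemma qproj_monoid : monoid_morphism qproj.
Proof. by split=> // x y; rewrite qprojM. Qed.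
HB.instance Definition _ :=
  GRing.isMonoidMorphism.Build A (quotring I) qproj qproj_monoid.

Definition qscale (c : A) (x : quotring I) : quotring I := qproj c * x.
Lemma qscaleA c d x : qscale c (qscale d x) = qscale (c * d) x.
Proof. by rewrite /qscale rmorphM mulrA. Qed.
Lemma qscale1 : left_id 1 qscale.
Proof. by move=> x; rewrite /qscale rmorph1 mul1r. Qed.
Lemma qscaleDr : right_distributive qscale +%R.
Proof. by move=> c x y; rewrite /qscale mulrDr. Qed.
Lemma qscaleDl x : {morph qscale^~ x : c d / c + d}.
Proof. by move=> c d; rewrite /qscale rmorphD mulrDl. Qed.
HB.instance Definition _ := GRing.Zmodule_isLmodule.Build A (quotring I)
  qscaleA qscale1 qscaleDr qscaleDl.

End QuotientRing.

Section QuotientComRing.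
Variables (R : comPzRingType) (I : ideal R).
Lemma qmulC : @commutative (quotring I) _ *%R.
Proof.
by move=> x y; rewrite -[x]qreprK -[y]qreprK -!rmorphM mulrC.
Qed.
HB.instance Definition _ :=
  GRing.PzRing_hasCommutativeMul.Build (quotring I) qmulC.
End QuotientComRing.

Section IdealPowers.
Variable R : comPzRingType.

Lemma ideal_full_zmod_closed : zmod_closed (predT : {pred R}). Proof. by []. Qed.
Definition ideal_full : ideal R :=
  Ideal ideal_full_zmod_closed (fun _ _ _ => isT) (fun _ _ _ => isT).

Definition ideal_mul_pred (I J : ideal R) : {pred R} := fun x =>
  `[< exists2 s : seq (R * R),
        all (fun p => (p.1 \in ideal_mem I) && (p.2 \in ideal_mem J)) s &
        x = \sum_(p <- s) p.1 * p.2 >].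

Variables I J : ideal R.

Lemma ideal_mul_Ml c :
  {in ideal_mul_pred I J, forall x, c * x \in ideal_mul_pred I J}.
Proof.
move=> x /asboolP[s sIJ ->]; apply/asboolP.
exists [seq (c * p.1, p.2) | p <- s].
  rewrite all_map; apply: sub_all sIJ => p /= /andP[pI ->].
  by rewrite ideal_Ml.
by rewrite big_map mulr_sumr; apply: eq_bigr => p _; rewrite mulrA.
Qed.

Lemma ideal_mul_zmod_closed : zmod_closed (ideal_mul_pred I J).
Proof.
split; first by apply/asboolP; exists [::]; rewrite ?big_nil.
move=> x y xI; rewrite -mulN1r => /(ideal_mul_Ml (- 1)).
move: xI => /asboolP[s sIJ ->] /asboolP[t tIJ ->]; apply/asboolP.
by exists (s ++ t); rewrite ?all_cat ?sIJ // big_cat.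
Qed.

Lemma ideal_mul_Mr c :
  {in ideal_mul_pred I J, forall x, x * c \in ideal_mul_pred I J}.
Proof. by move=> x xI; rewrite mulrC; apply: ideal_mul_Ml. Qed.

Definition ideal_mul : ideal R :=
  Ideal ideal_mul_zmod_closed ideal_mul_Ml ideal_mul_Mr.

End IdealPowers.

Fixpoint ideal_pow (R : comPzRingType) (I : ideal R) (n : nat) : ideal R :=
  if n is k.+1 then ideal_mul (ideal_pow I k) I else ideal_full R.

Definition fin_gen_ideal (R : comPzRingType) (I : ideal R) : Prop :=
  exists2 s : seq R, {subset s <= ideal_mem I} &
    forall x, x \in ideal_mem I ->
      exists c : nat -> R, x = \sum_(i < size s) c i * s`_i.

Definition noetherian (R : comPzRingType) : Prop :=
  forall I : ideal R, fin_gen_ideal I.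

Definition is_proper (R : comPzRingType) (I : ideal R) : Prop :=
  1 \notin ideal_mem I.

Definition maximal_ideal (R : comPzRingType) (m : ideal R) : Prop :=
  is_proper m /\
  forall I : ideal R, {subset ideal_mem m <= ideal_mem I} -> is_proper I ->
    ideal_mem I =i ideal_mem m.

(* Bijectivity of the canonical map from R to the inverse limit of the        *)
(* R/I^n; an element of the limit is given by representatives u n.            *)
Definition adically_complete (R : comPzRingType) (I : ideal R) : Prop :=
  (forall x : R, (forall n, x \in ideal_mem (ideal_pow I n)) -> x = 0) /\
  (forall u : nat -> R,
     (forall n, u n.+1 - u n \in ideal_mem (ideal_pow I n)) ->
     exists x : R, forall n, x - u n \in ideal_mem (ideal_pow I n)).

Definition complete_local_ring (R : comPzRingType) : Prop :=
  noetherian R /\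
  exists m : ideal R,
    [/\ maximal_ideal m,
        forall m' : ideal R, maximal_ideal m' -> ideal_mem m' =i ideal_mem m &
        adically_complete m].

(* Right modules over A are lmodType A^c: (c : A^c) *: v is v.c.              *)

Definition fin_gen (A : pzRingType) (V : lmodType A) : Prop :=
  exists s : seq V, forall v : V,
    exists c : nat -> A, v = \sum_(i < size s) c i *: s`_i.

Definition projective (A : pzRingType) (P : lmodType A) : Prop :=
  forall (M N : lmodType A) (g : {linear M -> N}) (f : {linear P -> N}),
    (forall y, exists x, g x = y) ->
    exists h : {linear P -> M}, forall x, g (h x) = f x.

(* M is a right and N a left module over A, the actions being given as        *)
(* functions so that A may act on N through a ring morphism.                  *)
Section Tensor.
Variables (A : Type) (M N : zmodType) (ra : M -> A -> M) (la : A -> N -> N).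

Definition balanced (G : zmodType) (b : M -> N -> G) : Prop :=
  [/\ forall m m' n, b (m + m') n = b m n + b m' n,
      forall m n n', b m (n + n') = b m n + b m n' &
      forall m c n, b (ra m c) n = b m (la c n)].

Definition tensor_eval (G : zmodType) (b : M -> N -> G) (s : seq (M * N)) : G :=
  \sum_(p <- s) b p.1 p.2.

(* Two finite formal sums of pairs represent the same tensor iff no balanced  *)
(* map distinguishes them; this is the congruence generated by the bilinear   *)
(* and balancing relations.                                                   *)
Definition tensor_equiv (s t : seq (M * N)) : bool :=
  `[< forall (G : zmodType) (b : M -> N -> G), balanced b ->
        tensor_eval b s = tensor_eval b t >].

Lemma tensor_equiv_is_equiv : equiv_class_of tensor_equiv.
Proof.
split=> [s|s t|t s u].
- exact/asboolP.
- by apply/asboolP/asboolP => h G b bb; rewrite h.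
- move=> /asboolP st /asboolP tu; apply/asboolP => G b bb.
  by rewrite st // tu.
Qed.

Canonical tensor_equivRel := EquivRelPack tensor_equiv_is_equiv.
Canonical tensor_encModRel := defaultEncModRel tensor_equiv.

Definition tensor : Type := {eq_quot tensor_equiv}.
HB.instance Definition _ := EqQuotient.on tensor.
HB.instance Definition _ := Choice.on tensor.

Definition tensor_of (s : seq (M * N)) : tensor := \pi_{eq_quot tensor_equiv} s.
Definition tensor_repr (t : tensor) : seq (M * N) :=
  repr (t : {eq_quot tensor_equiv}).

Lemma tensor_reprK : cancel tensor_repr tensor_of. Proof. exact: reprK. Qed.

Lemma tensor_ofP s t : tensor_of s = tensor_of t <->
  forall (G : zmodType) (b : M -> N -> G), balanced b ->
    tensor_eval b s = tensor_eval b t.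
Proof.
split=> [/eqmodP/asboolP//|h]; exact/eqmodP/asboolP.
Qed.

Lemma tensor_repr_of (G : zmodType) (b : M -> N -> G) s : balanced b ->
  tensor_eval b (tensor_repr (tensor_of s)) = tensor_eval b s.
Proof. by move=> bb; apply: (tensor_ofP _ _).1 => //; rewrite tensor_reprK. Qed.

Definition tensor_zero : tensor := tensor_of [::].
Definition tensor_add (t u : tensor) : tensor :=
  tensor_of (tensor_repr t ++ tensor_repr u).
Definition tensor_opp (t : tensor) : tensor :=
  tensor_of [seq (- p.1, p.2) | p <- tensor_repr t].

Lemma tensor_eval_cat (G : zmodType) (b : M -> N -> G) s t :
  tensor_eval b (s ++ t) = tensor_eval b s + tensor_eval b t.
Proof. exact: big_cat. Qed.

Lemma tensor_eval_opp (G : zmodType) (b : M -> N -> G) s : balanced b ->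
  tensor_eval b [seq (- p.1, p.2) | p <- s] = - tensor_eval b s.
Proof.
case=> bl _ _; rewrite /tensor_eval big_map -sumrN; apply: eq_bigr => p _ /=.
have b0 n : b 0 n = 0 by apply: (addIr (b 0 n)); rewrite -bl !add0r.
by apply: (addIr (b p.1 p.2)); rewrite -bl !addNr.
Qed.

Lemma tensor_addA : associative tensor_add.
Proof.
move=> t u v; apply/tensor_ofP => G b bb.
by rewrite !tensor_eval_cat !tensor_repr_of // !tensor_eval_cat addrA.
Qed.
Lemma tensor_addC : commutative tensor_add.
Proof.
move=> t u; apply/tensor_ofP => G b bb.
by rewrite !tensor_eval_cat addrC.
Qed.
Lemma tensor_add0 : left_id tensor_zero tensor_add.
Proof.
move=> t; rewrite -[RHS]tensor_reprK; apply/tensor_ofP => G b bb.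
by rewrite tensor_eval_cat tensor_repr_of // /tensor_eval big_nil add0r.
Qed.
Lemma tensor_addN : left_inverse tensor_zero tensor_opp tensor_add.
Proof.
move=> t; apply/tensor_ofP => G b bb.
rewrite tensor_eval_cat tensor_repr_of // tensor_eval_opp // addNr.
by rewrite /tensor_eval big_nil.
Qed.

HB.instance Definition _ := GRing.isZmodule.Build tensor
  tensor_addA tensor_addC tensor_add0 tensor_addN.

Lemma tensor_of_cat s t : tensor_of (s ++ t) = tensor_of s + tensor_of t.
Proof.
apply/tensor_ofP => G b bb.
by rewrite !tensor_eval_cat !tensor_repr_of.
Qed.

End Tensor.

(* The map f (x) g, meaningful when f and g are additive and commute with the *)
(* actions.                                                                   *)
Definition tensor_map (A : Type) (M M' N N' : zmodType)
    (ra : M -> A -> M) (la : A -> N -> N)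
    (ra' : M' -> A -> M') (la' : A -> N' -> N')
    (f : M -> M') (g : N -> N') (t : tensor ra la) : tensor ra' la' :=
  tensor_of ra' la' [seq (f p.1, g p.2) | p <- tensor_repr t].

Arguments tensor_map {A M M' N N' ra la ra' la'} f g t.

Section TensorMap.
Variables (A : Type) (M M' N N' : zmodType).
Variables (ra : M -> A -> M) (la : A -> N -> N).
Variables (ra' : M' -> A -> M') (la' : A -> N' -> N').
Variables (f : {additive M -> M'}) (g : {additive N -> N'}).
Hypothesis fP : forall m c, f (ra m c) = ra' (f m) c.
Hypothesis gP : forall c n, g (la c n) = la' c (g n).

Local Notation tmap := (@tensor_map _ _ _ _ _ ra la ra' la' f g).

Lemma tensor_map_of s :
  tmap (tensor_of ra la s) = tensor_of ra' la' [seq (f p.1, g p.2) | p <- s].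
Proof.
apply/tensor_ofP => G b [b1 b2 b3].
rewrite /tensor_eval !big_map -!/(tensor_eval (fun m n => b (f m) (g n)) _).
apply: tensor_repr_of; split=> *; rewrite ?raddfD //.
by rewrite fP gP b3.
Qed.

Lemma tensor_map_zmod : zmod_morphism tmap.
Proof.
have tD t u : tmap (t + u) = tmap t + tmap u.
  rewrite -[t]tensor_reprK -[u]tensor_reprK -tensor_of_cat !tensor_map_of.
  by rewrite map_cat tensor_of_cat.
by move=> t u; apply: (addIr (tmap u)); rewrite -tD !subrK.
Qed.

End TensorMap.

Definition tensorR (R : comPzRingType) (M N : lmodType R) : zmodType :=
  tensor (fun (m : M) (c : R) => c *: m) (fun (c : R) (n : N) => c *: n).

Definition tensorR_map (R : comPzRingType) (M M' N N' : lmodType R)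
    (f : {linear M -> M'}) (g : {linear N -> N'}) :
    tensorR M N -> tensorR M' N' :=
  tensor_map f g.

Definition flat (R : comPzRingType) (M : lmodType R) : Prop :=
  forall (N N' : lmodType R) (g : {linear N -> N'}),
    injective g ->
    injective (tensorR_map (idfun : {linear M -> M}) g).

Record proj_resolution (R : comPzRingType) (M : lmodType R) := ProjResolution {
  pr_obj :> nat -> lmodType R;
  pr_d : forall i, {linear pr_obj i.+1 -> pr_obj i};
  pr_aug : {linear pr_obj 0%N -> M};
  pr_projective : forall i, projective (pr_obj i);
  pr_aug_surj : forall y, exists x, pr_aug x = y;
  pr_exact0 : forall x, pr_aug x = 0 <-> exists y, x = pr_d 0%N y;
  pr_exact : forall i x, pr_d i x = 0 <-> exists y, x = pr_d i.+1 y
}.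

(* t in ker (P_i (x) N -> P_(i-1) (x) N), with P_(-1) = 0                     *)
Definition tor_cycle (R : comPzRingType) (M : lmodType R)
    (P : proj_resolution M) (N : lmodType R) (i : nat) :
    tensorR (P i) N -> Prop :=
  match i with
  | 0 => fun=> True
  | k.+1 => fun t => tensorR_map (pr_d P k) (idfun : {linear N -> N}) t = 0
  end.

(* Tor_i^R(M, N) = 0, i.e. H_i(P (x)_R N) = 0 for a projective resolution P   *)
(* of M; the choice of P is immaterial.                                       *)
Definition Tor_vanishes (R : comPzRingType) (i : nat) (M N : lmodType R) :
    Prop :=
  exists P : proj_resolution M,
    forall t : tensorR (P i) N, tor_cycle t ->
      exists u : tensorR (P i.+1) N,
        t = tensorR_map (pr_d P i) (idfun : {linear N -> N}) u.

Section GradedPiece.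
Variables (R : comPzRingType) (a : ideal R) (n : nat).

Record ideal_sub := IdealSub {
  ideal_val : R;
  ideal_valP : ideal_val \in ideal_mem (ideal_pow a n)
}.
HB.instance Definition _ := [isSub of ideal_sub for ideal_val].
HB.instance Definition _ := [Choice of ideal_sub by <:].
HB.instance Definition _ := [SubChoice_isSubZmodule of ideal_sub by <:].
Lemma ideal_val_zmod : zmod_morphism ideal_val.
Proof. exact: (raddfB (val : ideal_sub -> R)). Qed.
HB.instance Definition _ :=
  GRing.isZmodMorphism.Build ideal_sub R ideal_val ideal_val_zmod.

Definition gr_pred : {pred ideal_sub} :=
  fun x => ideal_val x \in ideal_mem (ideal_pow a n.+1).
Lemma gr_pred_zmod_closed : zmod_closed gr_pred.
Proof.
split=> [|x y]; rewrite /in_mem /=; first by rewrite /gr_pred raddf0 rpred0.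
by rewrite /gr_pred => xI yI; rewrite raddfB; apply: rpredB.
Qed.
HB.instance Definition _ :=
  GRing.isZmodClosed.Build ideal_sub gr_pred gr_pred_zmod_closed.

Definition gr : Type := Quotient.quot gr_pred.
HB.instance Definition _ := GRing.Zmodule.on gr.

Definition gr_proj (x : ideal_sub) : gr := \pi_(Quotient.quot gr_pred) x.
Definition gr_repr (x : gr) : ideal_sub := repr (x : Quotient.quot gr_pred).
Lemma gr_reprK : cancel gr_repr gr_proj. Proof. exact: reprK. Qed.
Lemma gr_proj_eq x y : gr_proj x = gr_proj y <->
  ideal_val x - ideal_val y \in ideal_mem (ideal_pow a n.+1).
Proof.
rewrite -raddfB -[X in _ <-> is_true X]/(x - y \in gr_pred).
by rewrite Quotient.idealrBE; split=> [/eqP|/eqP].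
Qed.
Lemma gr_proj_zmod : zmod_morphism gr_proj.
Proof. by move=> x y; rewrite /gr_proj raddfB. Qed.
HB.instance Definition _ :=
  GRing.isZmodMorphism.Build ideal_sub gr gr_proj gr_proj_zmod.

Definition ideal_scale (c : R) (x : ideal_sub) : ideal_sub :=
  IdealSub (ideal_Ml c (ideal_valP x)).

(* The action of R/a, computed on representatives.                            *)
Definition gr_scale (c : quotring a) (x : gr) : gr :=
  gr_proj (ideal_scale (qrepr c) (gr_repr x)).

Lemma gr_scale_proj c x :
  gr_scale (qproj a c) (gr_proj x) = gr_proj (ideal_scale c x).
Proof.
pose c' := qrepr (qproj a c); pose x' := gr_repr (gr_proj x).
suff: c' * ideal_val x' - c * ideal_val x \in ideal_mem (ideal_pow a n.+1).
  by move=> h; apply/gr_proj_eq.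
rewrite -(subrK (c' * ideal_val x) (c' * ideal_val x')) -mulrBr -addrA -mulrBl rpredD //.
  by apply: ideal_Ml; apply/gr_proj_eq; rewrite gr_reprK.
rewrite -opprB mulNr rpredN mulrC; apply/asboolP.
exists [:: (ideal_val x, c - c')]; last by rewrite big_seq1.
by rewrite /= ideal_valP qproj_repr.
Qed.

Lemma gr_scaleA c d x : gr_scale c (gr_scale d x) = gr_scale (c * d) x.
Proof.
rewrite -[c]qreprK -[d]qreprK -[x]gr_reprK -rmorphM !gr_scale_proj.
by congr gr_proj; apply: val_inj; rewrite /= mulrA.
Qed.
Lemma gr_scale1 : left_id 1 gr_scale.
Proof.
move=> x; rewrite -[x]gr_reprK -(rmorph1 (qproj a)) gr_scale_proj.
by congr gr_proj; apply: val_inj; rewrite /= mul1r.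
Qed.
Lemma gr_scaleDr : right_distributive gr_scale +%R.
Proof.
move=> c x y; rewrite -[c]qreprK -[x]gr_reprK -[y]gr_reprK -raddfD.
rewrite !gr_scale_proj -raddfD.
congr gr_proj; apply: val_inj; rewrite [RHS](raddfD ideal_val).
by rewrite /= -mulrDr -(raddfD ideal_val).
Qed.
Lemma gr_scaleDl x : {morph gr_scale^~ x : c d / c + d}.
Proof.
move=> c d; rewrite -[c]qreprK -[d]qreprK -[x]gr_reprK -raddfD.
rewrite !gr_scale_proj -raddfD.
congr gr_proj; apply: val_inj; rewrite [RHS](raddfD ideal_val).
by rewrite /= -mulrDl.
Qed.
HB.instance Definition _ := GRing.Zmodule_isLmodule.Build (quotring a) gr
  gr_scaleA gr_scale1 gr_scaleDr gr_scaleDl.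

End GradedPiece.

Definition normally_flat (R : comPzRingType) (a : ideal R) : Prop :=
  forall n : nat, (0 < n)%N -> flat (gr a n : lmodType (quotring a)).

(* The library's algType excludes the zero ring, hence this record.           *)
Record algebra (R : comPzRingType) := Algebra {
  alg_ring :> pzRingType;
  alg_map : {rmorphism R -> alg_ring};
  alg_central : forall c x, alg_map c * x = x * alg_map c
}.

Definition alg_module (R : comPzRingType) (Lam : algebra R) : Type := Lam.

Section AlgModule.
Variables (R : comPzRingType) (Lam : algebra R).
HB.instance Definition _ := GRing.Zmodule.on (alg_module Lam).

Definition alg_scale (c : R) (x : alg_module Lam) : alg_module Lam :=
  alg_map Lam c * (x : Lam).
Lemma alg_scaleA c d x : alg_scale c (alg_scale d x) = alg_scale (c * d) x.
Proof. by rewrite /alg_scale rmorphM mulrA. Qed.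
Lemma alg_scale1 : left_id 1 alg_scale.
Proof. by move=> x; rewrite /alg_scale rmorph1 mul1r. Qed.
Lemma alg_scaleDr : right_distributive alg_scale +%R.
Proof. by move=> c x y; rewrite /alg_scale mulrDr. Qed.
Lemma alg_scaleDl x : {morph alg_scale^~ x : c d / c + d}.
Proof. by move=> c d; rewrite /alg_scale rmorphD mulrDl. Qed.
HB.instance Definition _ := GRing.Zmodule_isLmodule.Build R (alg_module Lam)
  alg_scaleA alg_scale1 alg_scaleDr alg_scaleDl.
End AlgModule.

Section ExtendedIdeal.
Variables (R : comPzRingType) (a : ideal R) (Lam : algebra R).

Definition ideal_ext_pred : {pred Lam} := fun x =>
  `[< exists2 s : seq (R * Lam), all (fun p => p.1 \in ideal_mem a) s &
        x = \sum_(p <- s) alg_map Lam p.1 * p.2 >].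

Lemma ideal_ext_Ml c :
  {in ideal_ext_pred, forall x, c * x \in ideal_ext_pred}.
Proof.
move=> x /asboolP[s sa ->]; apply/asboolP.
exists [seq (p.1, c * p.2) | p <- s]; first by rewrite all_map.
rewrite big_map mulr_sumr; apply: eq_bigr => p _ /=.
by rewrite mulrA -alg_central mulrA.
Qed.

Lemma ideal_ext_Mr c :
  {in ideal_ext_pred, forall x, x * c \in ideal_ext_pred}.
Proof.
move=> x /asboolP[s sa ->]; apply/asboolP.
exists [seq (p.1, p.2 * c) | p <- s]; first by rewrite all_map.
by rewrite big_map mulr_suml; apply: eq_bigr => p _ /=; rewrite mulrA.
Qed.

Lemma ideal_ext_zmod_closed : zmod_closed ideal_ext_pred.
Proof.
split; first by apply/asboolP; exists [::]; rewrite ?big_nil.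
move=> x y xI; rewrite -mulN1r => /(ideal_ext_Ml (- 1)).
move: xI => /asboolP[s sa ->] /asboolP[t ta ->]; apply/asboolP.
by exists (s ++ t); rewrite ?all_cat ?sa // big_cat.
Qed.

Definition ideal_ext : ideal Lam :=
  Ideal ideal_ext_zmod_closed ideal_ext_Ml ideal_ext_Mr.

End ExtendedIdeal.

(* Cochain complexes indexed by int. There is a differential for every pair   *)
(* of degrees, zero unless the degrees are consecutive: this avoids transport *)
(* along equalities of degrees.                                               *)
Record complex (A : pzRingType) := Complex {
  cobj :> int -> lmodType A;
  cd : forall i j, {linear cobj i -> cobj j};
  cd_shape : forall i j x, j != i + 1 -> cd i j x = 0;
  cd_cd : forall i j k x, cd j k (cd i j x) = 0
}.

Record chain_map (A : pzRingType) (P Q : complex A) := ChainMap {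
  cm_fun :> forall i, {linear P i -> Q i};
  cm_comm : forall i j x, cm_fun j (cd P i j x) = cd Q i j (cm_fun i x)
}.

Definition bounded_above (A : pzRingType) (P : complex A) : Prop :=
  exists n : int, forall i, (n < i)%R -> forall x : P i, x = 0.

Section Complexes.
Variable A : pzRingType.
Implicit Types P Q S : complex A.

Definition cm_id P : chain_map P P :=
  @ChainMap A P P (fun i => idfun) (fun _ _ _ => erefl).

Lemma cm_zero_subproof P Q i j x :
  (\0 : {linear P j -> Q j}) (cd P i j x) =
  cd Q i j ((\0 : {linear P i -> Q i}) x).
Proof. by rewrite /= raddf0. Qed.
Definition cm_zero P Q : chain_map P Q := ChainMap (@cm_zero_subproof P Q).

Lemma cm_comp_subproof P Q S (g : chain_map Q S) (f : chain_map P Q) i j x :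
  (g j \o f j) (cd P i j x) = cd S i j ((g i \o f i) x).
Proof. by rewrite /= !cm_comm. Qed.
Definition cm_comp P Q S (g : chain_map Q S) (f : chain_map P Q) :
    chain_map P S :=
  @ChainMap A P S (fun i => g i \o f i) (cm_comp_subproof g f).

Definition homotopic P Q (f g : chain_map P Q) : Prop :=
  exists h : forall i j, {linear P i -> Q j},
    forall i x, f i x - g i x =
      cd Q (i - 1) i (h i (i - 1) x) + h (i + 1) i (cd P i (i + 1) x).

Definition cocycle P i (x : P i) : Prop := cd P i (i + 1) x = 0.
Definition coboundary P i (x : P i) : Prop :=
  exists y : P (i - 1), x = cd P (i - 1) i y.

(* Injectivity and surjectivity of all the H^i(f).                            *)
Definition quasi_iso P Q (f : chain_map P Q) : Prop :=
  forall i,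
    (forall x, cocycle x -> coboundary (f i x) -> coboundary x) /\
    (forall y, cocycle y -> exists2 x, cocycle x & coboundary (y - f i x)).

Lemma quasi_iso_id P : quasi_iso (cm_id P).
Proof.
move=> i; split=> // y yc; exists y => //.
by exists 0; rewrite raddf0 /= subrr.
Qed.

Lemma quasi_iso_comp P Q S (g : chain_map Q S) (f : chain_map P Q) :
  quasi_iso g -> quasi_iso f -> quasi_iso (cm_comp g f).
Proof.
move=> qg qf i; have [gi gs] := qg i; have [fi fs] := qf i; split=> [x xc xb|].
  apply: fi => //; apply: gi => //.
  by rewrite /cocycle -cm_comm xc raddf0.
move=> z zc; have [y yc [u zu]] := gs z zc; have [x xc [v yv]] := fs y yc.
exists x => //; exists (u + g (i - 1) v).
by rewrite linearD -zu -cm_comm -yv linearB /= addrA subrK.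
Qed.

(* P[n], with differential (-1)^n d.                                          *)
Section Shift.
Variables (n : int) (P : complex A).

Definition shift_d i j (x : P (i + n)) : P (j + n) :=
  cd P (i + n) (j + n) x *~ ((- 1) ^ n).

Lemma shift_d_linear i j : linear (@shift_d i j).
Proof.
by move=> c x y; rewrite /shift_d linearP mulrzDl scalerMzr.
Qed.
HB.instance Definition _ i j :=
  GRing.isLinear.Build A (P (i + n)) (P (j + n)) _ (@shift_d i j)
    (@shift_d_linear i j).

Lemma shift_shape i j x : j != i + 1 -> @shift_d i j x = 0.
Proof.
move=> ij; rewrite /shift_d cd_shape ?mul0rz //.
by apply: contra ij => /eqP e; apply/eqP/(addIr n); rewrite e addrAC.
Qed.

Lemma shift_dd i j k x : @shift_d j k (@shift_d i j x) = 0.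
Proof. have cdMz y e : cd P (j + n) (k + n) (y *~ e) = cd P (j + n) (k + n) y *~ e.
  exact: raddfMz.
by rewrite /shift_d cdMz cd_cd !mul0rz. Qed.

Definition shift : complex A :=
  @Complex A (fun i => P (i + n)) (fun i j => @shift_d i j)
    shift_shape shift_dd.

End Shift.

(* For a class C of complexes, the localization of the homotopy category of C *)
(* at the quasi-isomorphisms, by calculus of fractions: morphisms are roofs   *)
(* P <- X -> Q with X in C and X -> P a quasi-isomorphism, up to roof_eq.     *)

Definition all_complexes (P : complex A) : Prop := True.

Definition Dminus_mod (P : complex A) : Prop :=
  bounded_above P /\ forall i, fin_gen (P i).

Record roof P Q := Roof {
  apex : complex A;
  den : chain_map apex P;
  den_qis : quasi_iso den;
  num : chain_map apex Q
}.

Definition roof_id P : roof P P := Roof (@quasi_iso_id P) (cm_id P).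
Definition roof_zero P Q : roof P Q := Roof (@quasi_iso_id P) (cm_zero P Q).

Section Localization.
Variable C : complex A -> Prop.

Definition roof_eq P Q (r s : roof P Q) : Prop :=
  exists (Z : complex A) (z : chain_map Z (apex r)) (w : chain_map Z (apex s)),
    [/\ C Z, quasi_iso (cm_comp (den r) z),
        homotopic (cm_comp (den r) z) (cm_comp (den s) w) &
        homotopic (cm_comp (num r) z) (cm_comp (num s) w)].

(* t represents the composite of r followed by s.                             *)
Definition roof_comp P Q S (r : roof P Q) (s : roof Q S) (t : roof P S) :
    Prop :=
  exists (Z : complex A) (z : chain_map Z (apex r)) (w : chain_map Z (apex s))
         (qz : quasi_iso z),
    [/\ C Z, homotopic (cm_comp (num r) z) (cm_comp (den s) w) &
        roof_eq (Roof (quasi_iso_comp (@den_qis _ _ r) qz)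
                      (cm_comp (num s) w)) t].

Definition derived_Hom_zero P Q : Prop :=
  forall r : roof P Q, C (apex r) -> roof_eq r (roof_zero P Q).

Definition derived_iso P Q : Prop :=
  exists (r : roof P Q) (s : roof Q P),
    [/\ C (apex r), C (apex s),
        roof_comp r s (roof_id P) & roof_comp s r (roof_id Q)].

End Localization.
End Complexes.

Section BaseChange.
Variables (A B : pzRingType) (phi : {rmorphism A -> B}).

(* M (x)_A B for a right A-module M, with the right action of B on B.         *)
Definition basechange (M : lmodType A^c) : Type :=
  tensor (fun (m : M) (c : A) => (c : A^c) *: m)
         (fun (c : A) (b : B) => phi c * b).

Section Module.
Variable M : lmodType A^c.
HB.instance Definition _ := GRing.Zmodule.on (basechange M).

Definition bc_scale (c : B^c) (t : basechange M) : basechange M :=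
  tensor_map idfun (fun b : B => b * (c : B)) t.

Lemma bc_scale_of c s :
  bc_scale c (tensor_of _ _ s) = tensor_of _ _ [seq (p.1, p.2 * (c : B)) | p <- s].
Proof.
have mulc_zmod : zmod_morphism (fun b : B => b * (c : B)).
  by move=> x y; rewrite mulrBl.
pose mulc := HB.pack_for {additive B -> B} (fun b : B => b * (c : B))
  (GRing.isZmodMorphism.Build B B _ mulc_zmod).
apply: (@tensor_map_of _ _ _ _ _ _ _ _ _ idfun mulc) => //= d b.
by rewrite mulrA.
Qed.

Lemma bc_scaleA c d t : bc_scale c (bc_scale d t) = bc_scale (c * d) t.
Proof.
rewrite -[t]tensor_reprK !bc_scale_of -map_comp.
by congr tensor_of; apply: eq_map => p /=; rewrite -mulrA.
Qed.
Lemma bc_scale1 : left_id 1 bc_scale.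
Proof.
move=> t; rewrite -[t in RHS]tensor_reprK -[t]tensor_reprK bc_scale_of tensor_reprK.
by congr tensor_of; rewrite -[RHS]map_id; apply: eq_map => -[m b] /=; rewrite mulr1.
Qed.
Lemma bc_scaleDr : right_distributive bc_scale +%R.
Proof.
move=> c t u; rewrite -[t]tensor_reprK -[u]tensor_reprK -tensor_of_cat.
by rewrite !bc_scale_of map_cat tensor_of_cat.
Qed.
Lemma bc_scaleDl t : {morph bc_scale^~ t : c d / c + d}.
Proof.
move=> c d; rewrite -[t]tensor_reprK !bc_scale_of -tensor_of_cat.
apply/tensor_ofP => G b [_ bD _].
rewrite tensor_eval_cat /tensor_eval !big_map -big_split.
by apply: eq_bigr => p _ /=; rewrite -bD -mulrDr.
Qed.
HB.instance Definition _ := GRing.Zmodule_isLmodule.Build B^c (basechange M)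
  bc_scaleA bc_scale1 bc_scaleDr bc_scaleDl.
End Module.

Section Map.
Variables (M N : lmodType A^c) (f : {linear M -> N}).

Definition bc_map (t : basechange M) : basechange N := tensor_map f idfun t.

Lemma bc_map_of s :
  bc_map (tensor_of _ _ s) = tensor_of _ _ [seq (f p.1, p.2) | p <- s].
Proof.
apply: (@tensor_map_of _ _ _ _ _ _ _ _ _ f idfun) => // m c.
exact: linearZ.
Qed.

Lemma bc_map_linear : linear bc_map.
Proof.
move=> c t u; rewrite -[t]tensor_reprK -[u]tensor_reprK.
rewrite [c *: _]bc_scale_of -tensor_of_cat !bc_map_of.
rewrite [c *: _]bc_scale_of -tensor_of_cat map_cat -!map_comp.
by [].
Qed.
HB.instance Definition _ := GRing.isLinear.Build B^c (basechange M)
  (basechange N) _ bc_map bc_map_linear.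
End Map.

Section Complex.
Variable P : complex A^c.

Lemma bc_cd_shape i j (t : basechange (P i)) :
  j != i + 1 -> bc_map (cd P i j) t = 0.
Proof.
move=> ij; rewrite -[t]tensor_reprK bc_map_of; apply/tensor_ofP => G b bb.
rewrite /tensor_eval big_map big_nil big1 // => p _ /=.
case: bb => bl _ _; rewrite cd_shape //.
by apply: (addIr (b 0 p.2)); rewrite -bl !add0r.
Qed.

Lemma bc_cd_cd i j k (t : basechange (P i)) :
  bc_map (cd P j k) (bc_map (cd P i j) t) = 0.
Proof.
rewrite -[t]tensor_reprK !bc_map_of -map_comp; apply/tensor_ofP => G b bb.
rewrite /tensor_eval big_map big_nil big1 // => p _ /=.
case: bb => bl _ _; rewrite cd_cd.
by apply: (addIr (b 0 p.2)); rewrite -bl !add0r.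
Qed.

Definition bc_complex : complex B^c :=
  @Complex B^c (fun i => basechange (P i) : lmodType B^c)
    (fun i j => bc_map (cd P i j)) bc_cd_shape bc_cd_cd.
End Complex.

(* A bounded above resolution of L by finitely generated projectives.         *)
Definition fgproj_resolution (F L : complex A^c) : Prop :=
  [/\ bounded_above F, forall i, projective (F i) /\ fin_gen (F i) &
      exists q : chain_map F L, quasi_iso q].

(* L (x)^L_A B is represented by F (x)_A B, for F a resolution of L.          *)
Definition is_lift (P : complex B^c) (L : complex A^c) : Prop :=
  Dminus_mod L /\
  exists2 F : complex A^c, fgproj_resolution F L &
    derived_iso (@Dminus_mod B^c) (bc_complex F) P.

End BaseChange.

(* Main.v *)
(* Fix a flat gr_n = a^n/a^(n+1); being finitely generated over the local     *)
(* ring R/a it is free, on the classes of elements x_j of a^n.  Hence an      *)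
(* element of a^n M is a combination of the x_j modulo a^(n+1) M, uniquely    *)
(* modulo a M when M is projective, and the Tor-vanishing passes from R/a and *)
(* R/a^n to R/a^(n+1) on one and the same projective resolution; the same     *)
(* uniqueness then holds for M = Lam.                                         *)
(*   For the lift, replace P by a bounded above complex of finitely generated *)
(* free modules, i.e. by matrices d with d d = 0 over Lam/a Lam.  If matrices *)
(* D over Lam lift d and D D = 0 modulo a^n, write D D = sum_j x_j C_j modulo *)
(* a^(n+1).  As D commutes with D D, each C_j reduces to a chain map P -> P[2]*)
(* and so to d h_j + h_j d; replacing D by D - sum_j x_j h_j makes D D vanish *)
(* modulo a^(n+1).  Lam is a-adically complete and separated, so the D        *)
(* converge to a differential over Lam.                                       *)

Require Import Defs.
Set Warnings "-notation-overridden,-ambiguous-paths,-notation-incompatible-prefix,-redundant-canonical-projection".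
From HB Require Import structures.
From mathcomp Require Import all_boot all_order all_algebra.
From mathcomp Require Import boolp functions.

Set Implicit Arguments.
Unset Strict Implicit.
Unset Printing Implicit Defensive.

Import Order.TTheory GRing.Theory Num.Theory.
Local Open Scope ring_scope.
Local Open Scope quotient_scope.

(** * Noetherian modules *)

(** The pivot is an independence property. If the [x j] represent a basis of a^n/a^(n+1) over R/a
    and sum x_j p_j lies in a^(n+1) M, then every p_j lies in a M. For M = R this is
    [gr_basis_exists]: the equational criterion [flat_trivial_rel] forces the relations of a minimal
    generating system into a. Coordinate functionals carry it to projective modules
    ([projective_indep]), and the vanishing of Tor_1 against R/a^n carries it to Lam
    ([gr_indep_module]).

    For the Tor statement, [exact_modP] rewrites vanishing against R/I as exactness of a projective
    resolution modulo I. [exact_mod_powS] then passes from a and a^n to a^(n+1), because a^n/a^(n+1)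
    is free over R/a.

    The lift is obstruction theory. [mx_resolution] makes P a complex of matrices. Extending a
    lifted differential from a^n to a^(n+1) meets one obstruction in Hom(P, P[2]) for each x_j.
    These obstructions are null-homotopic by [mx_null_homotopic], which lets [lift_step] correct the
    differential. [lift_differential] takes the limit, using completeness ([IM_complete]) and
    separation ([IM_separated], from Krull's intersection theorem). [mx_complex_is_lift] identifies
    the derived base change of the result with P. *)

Section Submodules.
Variables (A : pzRingType) (V : lmodType A).
Implicit Types (U : V -> Prop) (s t : seq V).

Definition is_submod U :=
  U 0 /\ forall c x y, U x -> U y -> U (c *: x + y).

Lemma submodP U c x y : is_submod U -> U x -> U y -> U (c *: x + y).
Proof. by move=> [_]; apply. Qed.

Lemma submod0 U : is_submod U -> U 0.
Proof. by case. Qed.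

Lemma submodD U x y : is_submod U -> U x -> U y -> U (x + y).
Proof. by move=> [_ h] Ux Uy; rewrite -[x]scale1r; apply: h. Qed.

Lemma submodZ U c x : is_submod U -> U x -> U (c *: x).
Proof. by move=> [h0 h] Ux; rewrite -[_ *: _]addr0; apply: h. Qed.

Lemma submodN U x : is_submod U -> U x -> U (- x).
Proof. by rewrite -scaleN1r; apply: submodZ. Qed.

Lemma submodB U x y : is_submod U -> U x -> U y -> U (x - y).
Proof. by move=> hU Ux Uy; apply: submodD => //; apply: submodN. Qed.

Lemma submodBK U x y : is_submod U -> U (x - y) -> U y -> U x.
Proof. by move=> hU h Uy; rewrite -[x](subrK y); apply: submodD. Qed.

Lemma submod_sum U (I : Type) (r : seq I) (P : pred I) (F : I -> V) :
  is_submod U -> (forall i, P i -> U (F i)) -> U (\sum_(i <- r | P i) F i).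
Proof.
by move=> hU h; elim/big_ind: _ => //; [case: hU|move=> x y; apply: submodD].
Qed.

Definition span s (v : V) := exists c : nat -> A,
  v = \sum_(i < size s) c i *: s`_i.

Lemma span_nil v : span [::] v <-> v = 0.
Proof.
by split=> [[c ->]|->]; [rewrite big_ord0|exists (fun=> 0); rewrite big_ord0].
Qed.

Lemma span_cons x s v :
  span (x :: s) v <-> exists c w, span s w /\ v = c *: x + w.
Proof.
split=> [[c ->]|[c [_ [[d ->] ->]]]].
  exists (c 0%N), (\sum_(i < size s) c i.+1 *: s`_i); split; first by exists (c \o S).
  by rewrite big_ord_recl.
by exists (fun i => if i is k.+1 then d k else c); rewrite big_ord_recl.
Qed.

Lemma span_submod s : is_submod (span s).
Proof.
split; first by exists (fun=> 0); rewrite big1 // => i _; rewrite scale0r.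
move=> a _ _ [c ->] [d ->]; exists (fun i => a * c i + d i).
rewrite scaler_sumr -big_split; apply: eq_bigr => i _.
by rewrite scalerDl scalerA.
Qed.

Lemma span_mem s x : x \in s -> span s x.
Proof.
elim: s => // y s IH; rewrite inE => /orP[/eqP->|/IH h].
  by apply/span_cons; exists 1, 0; rewrite scale1r addr0; split=> //; case: (span_submod s).
by apply/span_cons; exists 0, x; rewrite scale0r add0r.
Qed.

Lemma span_min U s v : is_submod U -> (forall x, x \in s -> U x) ->
  span s v -> U v.
Proof.
by move=> hU hs [c ->]; apply: submod_sum => // i _; apply: submodZ => //;
  apply/hs/mem_nth.
Qed.

Lemma span_sub s t v : {subset s <= t} -> span s v -> span t v.
Proof.
move=> st; apply: span_min; first exact: span_submod.
by move=> x /st; apply: span_mem.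
Qed.

Definition fg_sub U :=
  exists2 s, forall x, x \in s -> U x & forall x, U x -> span s x.

Definition noeth_mod := forall U, is_submod U -> fg_sub U.

(** The union of the chain is finitely generated, and its generators all occur at one stage. *)
Lemma noeth_acc (K : nat -> V -> Prop) :
  noeth_mod -> (forall n, is_submod (K n)) ->
  (forall n x, K n x -> K n.+1 x) -> exists N, forall n x, K n x -> K N x.
Proof.
move=> hV hK hS.
have mono m n x : (m <= n)%N -> K m x -> K n x.
  by move=> /subnK <- Kx; elim: (n - m)%N => //= k; apply: hS.
have [|s sU Us] := hV (fun x => exists n, K n x).
  split; first by exists 0%N; case: (hK 0%N).
  move=> c x y [m Kx] [n Ky]; exists (maxn m n).
  have [_] := hK (maxn m n); apply.
    by apply: mono Kx; rewrite leq_maxl.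
  by apply: mono Ky; rewrite leq_maxr.
have [N hN] : exists N, forall x, x \in s -> K N x.
  elim: s sU {Us} => [|x s IH] sU; first by exists 0%N.
  have [N hN] : exists N, forall x, x \in s -> K N x.
    by apply: IH => y ys; apply: sU; rewrite inE ys orbT.
  have [n Kx] := sU x (mem_head _ _).
  exists (maxn n N) => y; rewrite inE => /orP[/eqP->|/hN].
    by apply: mono Kx; rewrite leq_maxl.
  by apply: mono; rewrite leq_maxr.
exists N => n x Kx; apply: (span_min (hK N) hN); apply: Us; by exists n.
Qed.

(** Otherwise [choice] picks a strictly larger member for each one, and iterating contradicts
    [noeth_acc]. *)
Lemma noeth_max (F : (V -> Prop) -> Prop) U0 :
  noeth_mod -> (forall U, F U -> is_submod U) -> F U0 ->
  exists2 U, F U & forall U', F U' -> (forall x, U x -> U' x) ->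
    forall x, U' x -> U x.
Proof.
move=> hV hF FU0; apply: contrapT => hno.
have step (U : {U | F U}) : exists U' : {U | F U},
    (forall x, sval U x -> sval U' x) /\ ~ (forall x, sval U' x -> sval U x).
  apply: contrapT => h; apply: hno; exists (sval U); first exact: (svalP U).
  move=> U' FU' UU' x U'x; apply: contrapT => nUx; apply: h.
  by exists (exist _ U' FU'); split=> //= k; apply: nUx; apply: k.
have [f hf] := choice step.
pose K n := iter n f (exist _ U0 FU0).
have [N hN] := @noeth_acc (fun n => sval (K n)) hV
  (fun n => hF _ (svalP (K n))) (fun n => (hf (K n)).1).
exact: ((hf (K N)).2 (hN N.+1)).
Qed.

End Submodules.

Arguments span_submod {A V} s.

Definition noeth_ring (A : pzRingType) := noeth_mod (A^o : lmodType A).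

Section NoetherianModules.
Variables (A : pzRingType) (V : lmodType A).

(** The coefficients of [v] in elements of [U] form a left ideal with generators [t]. Lifts of these
    to [U], together with generators of the intersection of [U] with the span of [s], generate
    [U]. *)
Lemma span_fg_sub (s : seq V) (U : V -> Prop) : noeth_ring A ->
  is_submod U -> (forall x, U x -> span s x) -> fg_sub U.
Proof.
move=> hA; elim: s U => [|v s IH] U hU hs.
  by exists [::] => // x /hs.
pose good c w := span s w /\ U (c *: v + w).
have [|t tJ Jt] := hA (fun c : A^o => exists w, good c w).
  split.
    exists 0; split; first by case: (span_submod s).
    by rewrite scale0r add0r; case: hU.
  move=> a c d [w [sw Uw]] [z [sz Uz]]; exists (a *: w + z); split.
    exact: (submodP _ (span_submod s)).
  have -> : (a * (c : A) + (d : A) : A) *: v + (a *: w + z) =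
            a *: ((c : A) *: v + w) + ((d : A) *: v + z).
    by rewrite scalerDl scalerDr scalerA addrACA.
  exact: submodP.
have /choice[g hg] (c : A) : exists w, (exists w', good c w') -> good c w.
  by have [[w hw]|h] := pselect (exists w, good c w); [exists w|exists 0].
have [||s' s'U Us'] := IH (fun x => U x /\ span s x).
- split; first by split; [case: hU|case: (span_submod s)].
  move=> c x y [Ux sx] [Uy sy]; split; first exact: submodP.
  exact: (submodP _ (span_submod s)).
- by move=> x [].
pose u (c : A) : V := c *: v + g c.
have ut c : c \in t -> U (u c) by move=> /tJ/hg[].
exists (map u t ++ s').
  by move=> x; rewrite mem_cat => /orP[/mapP[c ct ->]|/s'U[]//]; apply: ut.
move=> x Ux; have [c [w [sw xE]]] := (span_cons _ _ _).1 (hs x Ux).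
have [d cE] : span t (c : A^o) by apply: Jt; exists w; split; rewrite -?xE.
pose y := \sum_(i < size t) d i *: u t`_i.
have ti (i : 'I_(size t)) : t`_i \in t by apply: mem_nth.
have Uy : U y.
  by apply: submod_sum => // i _; apply: submodZ => //; apply: ut.
have xy : span s' (x - y).
  apply: Us'; split; first exact: submodB.
  have ->: x - y = w - \sum_(i < size t) d i *: g t`_i.
    rewrite xE /y (eq_bigr _ (fun i _ => scalerDr _ _ _)) big_split /= opprD addrACA.
    rewrite [X in X + _](_ : _ = 0) ?add0r // cE scaler_suml; apply/eqP.
    by rewrite subr_eq0; apply/eqP/eq_bigr => i _; rewrite scalerA.
  apply: submodB => //; first exact: span_submod.
  apply: submod_sum => [|i _]; first exact: span_submod.
  apply: submodZ; first exact: span_submod.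
  by have [] := hg _ (tJ _ (ti i)).
rewrite -[x](subrK y); apply: submodD; first exact: span_submod.
  by apply: span_sub xy => z; rewrite mem_cat orbC => ->.
apply: submod_sum => [|i _]; first exact: span_submod.
apply: submodZ; first exact: span_submod.
by apply: span_mem; rewrite mem_cat map_f.
Qed.

Lemma fin_gen_noeth : noeth_ring A -> fin_gen V -> noeth_mod V.
Proof. by move=> hA [s hs] U hU; apply: (@span_fg_sub s) => // x _; apply: hs. Qed.

End NoetherianModules.

Lemma fin_gen_prod (A : pzRingType) (V W : lmodType A) :
  fin_gen V -> fin_gen W -> fin_gen (V * W)%type.
Proof.
move=> [s hs] [t ht]; exists ([seq (x, 0) | x <- s] ++ [seq (0, x) | x <- t]).
move=> [v w]; set l := _ ++ _; change (span l (v, w)).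
have -> : (v, w) = (v, 0) + (0, w) by congr (_, _); rewrite ?addr0 ?add0r.
apply: submodD; first exact: span_submod.
  apply: (@span_min _ _ (fun v : V => span l (v, 0)) s) => [|x xs|]; last exact: hs.
    split; first by case: (span_submod l).
    move=> c x y hx hy.
    have -> : (c *: x + y, 0) = c *: (x, 0) + (y, 0) :> V * W.
      by congr (_, _); rewrite /= scaler0 addr0.
    exact: (submodP _ (span_submod l)).
  by apply: span_mem; rewrite mem_cat (map_f (fun x => (x, 0))).
apply: (@span_min _ _ (fun w : W => span l (0, w)) t) => [|x xs|]; last exact: ht.
  split; first by case: (span_submod l).
  move=> c x y hx hy.
  have -> : (0, c *: x + y) = c *: (0, x) + (0, y) :> V * W.
    by congr (_, _); rewrite /= scaler0 addr0.
  exact: (submodP _ (span_submod l)).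
by apply: span_mem; rewrite mem_cat orbC (map_f (fun x => (0, x))).
Qed.

Section RowVectors.
Variables (A : pzRingType) (n : nat) (V : lmodType A).

Definition row_comb_fun (p : 'I_n -> V) (x : 'rV[A]_n) : V :=
  \sum_(j < n) x 0 j *: p j.

Lemma row_comb_linear p : linear (row_comb_fun p).
Proof.
move=> c x y; rewrite /row_comb_fun scaler_sumr -big_split; apply: eq_bigr => j _.
by rewrite !mxE scalerDl scalerA.
Qed.

HB.instance Definition _ p :=
  GRing.isLinear.Build A 'rV[A]_n V _ (row_comb_fun p) (row_comb_linear p).

Definition row_comb p : {linear 'rV[A]_n -> V} := row_comb_fun p.

Lemma row_combE p x : row_comb p x = \sum_(j < n) x 0 j *: p j.
Proof. by []. Qed.

(** A linear relation defined everywhere on a free module contains a linear map: choose values on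
    the standard basis. This serves for projectivity and for choosing homotopies linearly. *)
Lemma row_choice (Q : 'rV[A]_n -> V -> Prop) :
  (forall c x y z t, Q x y -> Q z t -> Q (c *: x + z) (c *: y + t)) ->
  (forall x, exists y, Q x y) ->
  exists h : {linear 'rV[A]_n -> V}, forall x, Q x (h x).
Proof.
move=> Qlin Qex; have Q00 : Q 0 0.
  have [y Qy] := Qex 0; have := Qlin (-1) _ _ _ _ Qy Qy.
  by rewrite scaler0 addr0 scaleN1r addNr.
have /choice[p hp] j := Qex 'e_j; exists (row_comb p) => x.
rewrite {1}[x]row_sum_delta row_combE.
elim/big_rec2: _ => // j y z _; exact: Qlin.
Qed.

End RowVectors.

Lemma row_projective (A : pzRingType) n : projective ('rV[A]_n : lmodType A).
Proof.
move=> M N g f gs; apply: (row_choice (Q := fun x y => g y = f x)) => // c x y z t.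
by rewrite !linearP => -> ->.
Qed.

Lemma row_fin_gen (A : pzRingType) n : fin_gen ('rV[A]_n : lmodType A).
Proof.
exists [seq 'e_j | j : 'I_n] => v; rewrite -/(span _ v).
rewrite [v]row_sum_delta; apply: submod_sum => [|j _]; first exact: span_submod.
apply: submodZ; first exact: span_submod.
by apply: span_mem; apply: map_f; rewrite mem_enum.
Qed.

(** * Ideals acting on modules, local rings *)

Section IdealTimesModule.
Variables (R : comPzRingType).
Implicit Types (I J : ideal R) (M N : lmodType R).

Definition in_IM M I (x : M) := exists2 s : seq (R * M),
  all (fun p => p.1 \in ideal_mem I) s & x = \sum_(p <- s) p.1 *: p.2.

Lemma IM_submod M I : is_submod (@in_IM M I).
Proof.
split; first by exists [::]; rewrite ?big_nil.
move=> c _ _ [s sI ->] [t tI ->].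
exists ([seq (p.1, c *: p.2) | p <- s] ++ t).
  by rewrite all_cat all_map; apply/andP; split.
rewrite big_cat big_map scaler_sumr /=; congr (_ + _); apply: eq_bigr => p _.
by rewrite !scalerA mulrC.
Qed.

Arguments IM_submod {M} I.

Lemma IM_scale M I c (x : M) : c \in ideal_mem I -> in_IM I (c *: x).
Proof. by move=> cI; exists [:: (c, x)]; rewrite ?big_seq1 //= cI. Qed.

Lemma IM_min M I (U : M -> Prop) x : is_submod U ->
  (forall c y, c \in ideal_mem I -> U (c *: y)) -> in_IM I x -> U x.
Proof.
move=> hU h [s sI ->]; rewrite big_seq; apply: submod_sum => // p /(allP sI).
exact: h.
Qed.

Lemma IM_sub M I J (x : M) : {subset ideal_mem I <= ideal_mem J} ->
  in_IM I x -> in_IM J x.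
Proof.
move=> IJ; apply: (IM_min (IM_submod J)).
by move=> c y /IJ; apply: IM_scale.
Qed.

Lemma submod_preim M N (f : {linear M -> N}) (U : N -> Prop) :
  is_submod U -> is_submod (fun x => U (f x)).
Proof.
move=> hU; split; first by rewrite linear0; apply: submod0.
by move=> c x y Ux Uy; rewrite linearP; apply: submodP.
Qed.

Lemma IM_linear M N (f : {linear M -> N}) I x : in_IM I x -> in_IM I (f x).
Proof.
apply: (IM_min (U := fun x => in_IM I (f x))) => [|c y cI].
  exact/submod_preim/IM_submod.
by rewrite linearZ_LR; apply: IM_scale.
Qed.

Lemma IM_linear_lift M N (f : {linear M -> N}) I y :
  (forall y, exists x, f x = y) -> in_IM I y -> exists2 x, in_IM I x & f x = y.
Proof.
move=> fs; apply: (IM_min (U := fun y => exists2 x, in_IM I x & f x = y)) => [|c z cI].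
  split; first by exists 0; rewrite ?linear0 //; apply: (submod0 (IM_submod _)).
  move=> c _ _ [x hx <-] [x' hx' <-]; exists (c *: x + x'); last by rewrite linearP.
  exact: (submodP _ (IM_submod _)).
have [x <-] := fs z; exists (c *: x); last exact: linearZ_LR.
exact: IM_scale.
Qed.

Lemma IM_full M (x : M) : in_IM (ideal_full R) x.
Proof. by rewrite -[x]scale1r; apply: IM_scale. Qed.

Lemma IM_regular I (x : R^o) : in_IM I x <-> (x : R) \in ideal_mem I.
Proof.
split=> [[s sI ->]|xI].
  by rewrite big_seq rpred_sum // => p /(allP sI) /= pI; apply: ideal_Mr.
by exists [:: (x : R, 1 : R^o)]; rewrite ?big_seq1 /= ?xI //; rewrite [RHS]mulr1.
Qed.

Lemma ideal_submod I : is_submod (fun x : R^o => (x : R) \in ideal_mem I).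
Proof.
split=> [|c x y xI yI]; first exact: rpred0.
by apply: rpredD => //; apply: ideal_Ml.
Qed.

Lemma ideal_mul_mem I J x y : x \in ideal_mem I -> y \in ideal_mem J ->
  x * y \in ideal_mem (ideal_mul I J).
Proof.
by move=> xI yJ; apply/asboolP; exists [:: (x, y)]; rewrite ?big_seq1 //= xI yJ.
Qed.

Lemma ideal_mul_min I J (U : R^o -> Prop) x : is_submod U ->
  (forall y z, y \in ideal_mem I -> z \in ideal_mem J -> U (y * z)) ->
  x \in ideal_mem (ideal_mul I J) -> U x.
Proof.
move=> hU h /asboolP[s sIJ ->]; rewrite big_seq.
by apply: (submod_sum _ hU) => p /(allP sIJ)/andP[]; apply: h.
Qed.

Lemma IM_mul M I J c (x : M) :
  c \in ideal_mem J -> in_IM I x -> in_IM (ideal_mul I J) (c *: x).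
Proof.
move=> cJ; apply: (IM_min (U := fun x => in_IM _ (c *: x))) => [|d y dI].
  split; first by rewrite scaler0; apply: (submod0 (IM_submod _)).
  move=> d y z hy hz; rewrite scalerDr scalerA mulrC -scalerA.
  exact: (submodP _ (IM_submod _)).
by rewrite scalerA mulrC; apply: IM_scale; apply: ideal_mul_mem.
Qed.

Lemma submod_mulr (U : R^o -> Prop) z : is_submod U ->
  is_submod (fun y : R^o => U ((y : R) * z)).
Proof.
move=> hU; split; first by rewrite mul0r; exact: (submod0 hU).
move=> c x y Ux Uy; rewrite [X in U X](_ : _ = c *: ((x * z : R) : R^o) + (y * z : R)).
  exact: (submodP _ hU).
by rewrite mulrDl; congr (_ + _); exact: (esym (mulrA _ _ _)).
Qed.

Lemma ideal_powS_sub I n :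
  {subset ideal_mem (ideal_pow I n.+1) <= ideal_mem (ideal_pow I n)}.
Proof.
move=> x; apply: (ideal_mul_min (ideal_submod _)).
by move=> y z yI _; apply: ideal_Mr.
Qed.

Lemma ideal_pow_le I m n : (m <= n)%N ->
  {subset ideal_mem (ideal_pow I n) <= ideal_mem (ideal_pow I m)}.
Proof.
by move=> /subnK <- x; elim: (n - m)%N => //= k IH; move/ideal_powS_sub/IH.
Qed.

Lemma ideal_pow1 I x : (x \in ideal_mem (ideal_pow I 1)) = (x \in ideal_mem I).
Proof.
apply/idP/idP => [|xI]; last by rewrite -[x]mul1r; apply: ideal_mul_mem.
apply: (ideal_mul_min (ideal_submod _)).
by move=> y z _; apply: ideal_Ml.
Qed.

Lemma ideal_powD_min I m n (U : R^o -> Prop) x : is_submod U ->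
  (forall y z, y \in ideal_mem (ideal_pow I m) ->
    z \in ideal_mem (ideal_pow I n) -> U (y * z)) ->
  x \in ideal_mem (ideal_pow I (m + n)) -> U x.
Proof.
elim: n U x => [|n IH] U x hU h.
  by rewrite addn0 => xI; rewrite -[x]mulr1; apply: h.
rewrite addnS; apply: (ideal_mul_min hU) => y z yI zI.
apply: (IH (fun y : R^o => U ((y : R) * z))) => //; first exact: submod_mulr.
by move=> u v uI vI; rewrite -mulrA; apply: h => //; apply: ideal_mul_mem.
Qed.

Lemma ideal_powD_mem I m n x y : x \in ideal_mem (ideal_pow I m) ->
  y \in ideal_mem (ideal_pow I n) -> x * y \in ideal_mem (ideal_pow I (m + n)).
Proof.
move=> xI; elim: n y => [|n IH] y; first by rewrite addn0 => _; apply: ideal_Mr.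
rewrite addnS; apply: (ideal_mul_min (U := fun y => x * y \in ideal_mem _)).
  split; first by rewrite mulr0 rpred0.
  move=> c u v uI vI; rewrite mulrDr rpredD // [c *: u]/(_ * _) mulrCA.
  exact: ideal_Ml.
by move=> u v uI vI; rewrite mulrA; apply: ideal_mul_mem => //; apply: IH.
Qed.

Lemma ideal_pow_sub I J n : {subset ideal_mem I <= ideal_mem J} ->
  {subset ideal_mem (ideal_pow I n) <= ideal_mem (ideal_pow J n)}.
Proof.
move=> IJ; elim: n => // n IH x.
apply: (ideal_mul_min (ideal_submod _)).
by move=> y z /IH yJ /IJ; apply: ideal_mul_mem.
Qed.

Lemma ideal_pow_prod_min I n (U : R^o -> Prop) x : is_submod U ->
  (forall l : seq R, size l = n -> all (fun c => c \in ideal_mem I) l ->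
    U (\prod_(c <- l) c)) ->
  x \in ideal_mem (ideal_pow I n) -> U x.
Proof.
elim: n U x => [|n IH] U x hU h.
  move=> _; rewrite -[x]mulr1; apply: (submodZ (V := R^o)) => //.
  by have := h [::]; rewrite big_nil; apply.
apply: (ideal_mul_min hU) => y z yI zI.
apply: (IH (fun y : R^o => U ((y : R) * z))) => //; first exact: submod_mulr.
move=> l ln lI; have := h (z :: l); rewrite big_cons mulrC; apply=> /=.
  by rewrite ln.
by rewrite zI.
Qed.

Lemma IM_span M I (t : seq M) x : (forall y, span t y) -> in_IM I x ->
  exists2 c : nat -> R, forall i, c i \in ideal_mem I &
    x = \sum_(i < size t) c i *: t`_i.
Proof.
move=> ht; apply: (IM_min (U := fun x => exists2 c : nat -> R,
  forall i, c i \in ideal_mem I & x = \sum_(i < size t) c i *: t`_i)) => [|c y cI].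
  split.
    by exists (fun=> 0) => [i|]; rewrite ?rpred0 // big1 // => i _; rewrite scale0r.
  move=> a _ _ [c cI ->] [d dI ->]; exists (fun i => a * c i + d i).
    by move=> i; rewrite rpredD // ideal_Ml.
  rewrite scaler_sumr -big_split; apply: eq_bigr => i _.
  by rewrite scalerDl scalerA.
have [d ->] := ht y; exists (fun i => c * d i) => [i|]; first exact: ideal_Mr.
by rewrite scaler_sumr; apply: eq_bigr => i _; rewrite scalerA.
Qed.

End IdealTimesModule.

Arguments IM_submod {R M} I.

Section LocalRing.
Variables (R : comPzRingType).

Definition submod_ideal (U : R^o -> Prop) (hU : is_submod U) : ideal R.
Proof.
apply: (@Ideal R (fun x : R => `[< U x >])).
- split=> [|x y /asboolP Ux /asboolP Uy]; apply/asboolP; first exact: (submod0 hU).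
  exact: (submodB (V := R^o)).
- by move=> c x /asboolP Ux; apply/asboolP; apply: (submodZ (V := R^o)).
by move=> c x /asboolP Ux; apply/asboolP; rewrite mulrC; apply: (submodZ (V := R^o)).
Defined.

Lemma noetherian_noeth_ring : noetherian R -> noeth_ring R.
Proof.
move=> hR U hU; have [s sU Us] := hR (submod_ideal hU).
exists s => [x /sU/asboolP//|x Ux].
by have [|c ->] := Us x; [apply/asboolP|exists c].
Qed.

End LocalRing.

(** * Krull's intersection theorem *)

Section KrullIntersection.
Variables (R : comPzRingType) (M : lmodType R).
Hypothesis hM : noeth_mod M.

Lemma colon_submod (K : M -> Prop) (b : R) : is_submod K ->
  is_submod (fun y => K (b *: y)).
Proof.
move=> hK; split; first by rewrite scaler0; exact: (submod0 hK).
by move=> c y z Ky Kz; rewrite scalerDr scalerA mulrC -scalerA; apply: submodP.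
Qed.

Lemma span_prod_colon (K : M -> Prop) (s : seq (R^o : lmodType R)) :
  is_submod K -> (forall b, b \in s -> exists t, forall y : M, K ((b : R) ^+ t *: y)) ->
  exists N, forall (l : seq R) (y : M), (N <= size l)%N ->
    (forall c, c \in l -> span s c) -> K (\prod_(c <- l) c *: y).
Proof.
move=> hK; elim: s => [|b s IH] hs.
  exists 1%N => -[|c l] // y _ hl.
  have /span_nil -> := hl c (mem_head _ _).
  by rewrite big_cons mul0r scale0r; exact: (submod0 hK).
have [|N hN] := IH; first by move=> c cs; apply: hs; rewrite inE cs orbT.
have [t ht] := hs b (mem_head _ _).
(* Expanding the product of the [e b + d], each term has at least t factors b *)
(* or at least N factors d.                                                   *)
suff key (l : seq R) : (forall c, c \in l -> span (b :: s) c) ->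
    forall u (l' : seq R) y, (forall c, c \in l' -> span s c) ->
      (t + N <= u + size l' + size l)%N ->
      K (((b : R) ^+ u * (\prod_(c <- l') c) * \prod_(c <- l) c) *: y).
  exists (t + N)%N => l y ln hl; have := key l hl 0%N [::] y.
  by rewrite big_nil expr0 !mul1r; apply.
elim: l => [|c l IHl] hl u l' y hl' hu.
  rewrite big_nil mulr1; have [tu|ut] := leqP t u.
    by rewrite -(subnK tu) exprD -mulrA mulrCA -scalerA; apply: ht.
  rewrite -scalerA; apply: (submodZ _ hK); apply: hN => //.
  rewrite -(leq_add2l u); apply: (@leq_trans (t + N)); first by rewrite leq_add2r ltnW.
  by move: hu; rewrite addn0.
have [e [d [hd cE]]] := (span_cons _ _ _).1 (hl c (mem_head _ _)).
have hl2 c' : c' \in l -> span (b :: s) c' by move=> c'l; apply: hl; rewrite inE c'l orbT.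
have -> : (b : R) ^+ u * (\prod_(c <- l') c) * (\prod_(c <- c :: l) c) =
    e * ((b : R) ^+ u.+1 * (\prod_(c <- l') c) * (\prod_(c <- l) c)) +
    (b : R) ^+ u * (\prod_(c <- d :: l') c) * (\prod_(c <- l) c).
  rewrite !big_cons {1}cE exprSr; set p := \prod_(c <- l') c; set q := \prod_(c <- l) c.
  rewrite -[e *: b]/(e * (b : R)) mulrDl mulrDr; congr (_ + _); last first.
    by rewrite -[in RHS](mulrA _ _ q) -(mulrA d) -mulrA (mulrCA p).
  by rewrite -!mulrA (mulrCA p e) (mulrCA _ e) (mulrCA p (b : R)).
rewrite scalerDl -(scalerA e); apply: (submodP _ hK); apply: IHl => //.
- by move: hu; rewrite /= addnS !addSn.
- by move=> c'; rewrite inE => /orP[/eqP->|/hl'].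
- by move: hu; rewrite /= !addnS addSn.
Qed.

(** Maximality replaces the Artin-Rees lemma. A submodule [K] maximal among those that meet Rx
    exactly in Ix absorbs a power of each generator of I, hence some I^N M, hence [x]. *)
Lemma krull_intersection (I : ideal R) (x : M) :
  fg_sub (fun c : R^o => (c : R) \in ideal_mem I) ->
  (forall n, in_IM (ideal_pow I n) x) -> exists2 c, c \in ideal_mem I & x = c *: x.
Proof.
move=> [s sI Is] hx.
pose Ix (y : M) := exists2 c, c \in ideal_mem I & y = c *: x.
have hIx : is_submod Ix.
  split; first by exists 0; rewrite ?rpred0 ?scale0r.
  move=> a _ _ [c cI ->] [d dI ->]; exists (a * c + d).
    by rewrite rpredD // ideal_Ml.
  by rewrite scalerDl scalerA.
pose F (K : M -> Prop) := [/\ is_submod K, forall y, Ix y -> K y &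
  forall r, K (r *: x) -> Ix (r *: x)].
(* A submodule K maximal with K /\ Rx = Ix contains I^N M.                   *)
have [K [hK IxK KIx] Kmax] : exists2 K, F K & forall K', F K' ->
    (forall y, K y -> K' y) -> forall y, K' y -> K y.
  by apply: (@noeth_max _ _ F Ix hM) => [U []|].
have pow_in b : b \in s -> exists t, forall y : M, K ((b : R) ^+ t *: y).
  move=> /sI bI.
  have [||t ht] := @noeth_acc _ _ (fun n y => K ((b : R) ^+ n *: y)) hM.
  - by move=> n; apply: colon_submod.
  - by move=> n y Ky; rewrite exprS -scalerA; apply: submodZ.
  (* If r x = b^t y + k with k in [K], then b r x is in Ix, so b^(t+1) y is in [K]. The colon
     submodules are stationary from [t] on, so b^t y is in [K] too. Hence K + b^t M still meets Rx
     in Ix, and maximality applies. *)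
  pose K' z := exists y, exists2 k, K k & z = (b : R) ^+ t *: y + k.
  have hK' : is_submod K'.
    split; first by exists 0, 0; rewrite ?scaler0 ?addr0 //; exact: (submod0 hK).
    move=> c _ _ [y [k Kk ->]] [z [l Kl ->]].
    exists (c *: y + z), (c *: k + l); first exact: submodP.
    by rewrite !scalerDr !scalerA [c * _]mulrC addrACA.
  exists t => y; apply: (Kmax K') => [|z Kz|].
  - split=> // [z Ixz|r [z [k Kk rE]]].
      by exists 0, z; rewrite ?scaler0 ?add0r //; apply: IxK.
    apply: KIx; rewrite rE; apply: submodD => //; apply: (ht t.+1).
    have -> : (b : R) ^+ t.+1 *: z = (b : R) *: (r *: x) - (b : R) *: k.
      by rewrite rE scalerDr addrK scalerA exprS.
    apply: submodB => //; last exact: submodZ.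
    by apply: IxK; exists ((b : R) * r); rewrite ?scalerA //; apply: ideal_Mr.
  - by exists 0, z; rewrite ?scaler0 ?add0r.
  - by exists y, 0; rewrite ?addr0 //; exact: (submod0 hK).
have [N hN] := span_prod_colon hK pow_in.
have : K x.
  apply: (IM_min hK _ (hx N)) => c y cI.
  apply: (ideal_pow_prod_min (U := fun c : R^o => K ((c : R) *: y)) _ _ cI).
    split; first by rewrite scale0r; exact: (submod0 hK).
    move=> a u v Ku Kv; rewrite scalerDl -[(a *: u)]/(a * (u : R)) -scalerA.
    exact: submodP.
  by move=> l lN lI; apply: hN; rewrite ?lN // => d /(allP lI); apply: Is.
by rewrite -[x in K x]scale1r => /KIx; rewrite scale1r.
Qed.

End KrullIntersection.

(** * Local rings: separation and completeness for a proper ideal *)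

Section LocalRings.
Variables (R : comPzRingType) (m : ideal R).
Hypothesis hR : noetherian R.
Hypothesis hmax : maximal_ideal m.
Hypothesis huniq : forall m' : ideal R, maximal_ideal m' -> ideal_mem m' =i ideal_mem m.

(** Noetherianity yields an ideal maximal among the proper ones containing [I]; by uniqueness it is
    [m]. *)
Lemma proper_sub_max (I : ideal R) : is_proper I ->
  {subset ideal_mem I <= ideal_mem m}.
Proof.
move=> hI; pose F (U : R^o -> Prop) := [/\ is_submod U, ~ U (1 : R) &
  forall x : R, x \in ideal_mem I -> U x].
have [U [hU U1 IU] Umax] : exists2 K, F K & forall K', F K' ->
    (forall y, K y -> K' y) -> forall y, K' y -> K y.
  apply: (@noeth_max _ _ F (fun x : R^o => (x : R) \in ideal_mem I)).
  - exact: noetherian_noeth_ring.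
  - by move=> U [].
  - by split=> //; [exact: ideal_submod|exact/negP].
have hm : maximal_ideal (submod_ideal hU).
  split; first by apply/negP => /asboolP.
  move=> J UJ J1 x; apply/idP/idP => [xJ|/UJ//]; apply/asboolP.
  apply: (Umax (fun x : R^o => (x : R) \in ideal_mem J)) => //.
    split; [exact: ideal_submod|exact/negP|].
    by move=> y yI; apply: UJ; apply/asboolP; apply: IU.
  by move=> y Uy; apply: UJ; apply/asboolP.
by move=> x xI; rewrite -(huniq hm); apply/asboolP/IU.
Qed.

Lemma local_inv (x : R) : x \notin ideal_mem m -> exists y, y * x = 1.
Proof.
move=> xm; apply: contrapT => hx.
have hU : is_submod (fun z : R^o => exists y : R, z = y * x).
  split; first by exists 0; rewrite mul0r.
  move=> a _ _ [y ->] [z ->]; exists (a * y + z).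
  by rewrite mulrDl -mulrA.
case/negP: xm; apply: (@proper_sub_max (submod_ideal hU)).
  by apply/negP => /asboolP[y y1]; apply: hx; exists y.
by apply/asboolP; exists 1; rewrite mul1r.
Qed.

Lemma max_proper : 1 \notin ideal_mem m.
Proof. by case: hmax. Qed.

Lemma local_unit1 (c : R) : c \in ideal_mem m -> exists y, y * (1 - c) = 1.
Proof.
move=> cm; apply: local_inv; apply: contra max_proper => h.
by rewrite -(subrK c 1) rpredD.
Qed.

Variable a : ideal R.
Hypothesis ha : is_proper a.

(** Krull's theorem gives x = c x with c in a, and 1 - c is a unit because a lies in m. *)
Lemma IM_separated (M : lmodType R) (x : M) : fin_gen M ->
  (forall n, in_IM (ideal_pow a n) x) -> x = 0.
Proof.
move=> hM hx; have hR' := noetherian_noeth_ring hR.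
have [|c cI xE] := krull_intersection (fin_gen_noeth hR' hM) _ hx.
  by apply: hR'; apply: ideal_submod.
have [y y1] := local_unit1 (proper_sub_max ha cI).
by rewrite -[x]scale1r -y1 -scalerA scalerBl scale1r -xE subrr scaler0.
Qed.

Hypothesis hcompl : adically_complete m.

Lemma series_limit (I : ideal R) (c : nat -> R) : {subset ideal_mem I <= ideal_mem m} ->
  (forall n, c n \in ideal_mem (ideal_pow I n)) ->
  exists s, forall N, s - \sum_(i < N) c i \in ideal_mem (ideal_pow m N).
Proof.
move=> Im cI; apply: hcompl.2 => n; rewrite big_ord_recr /= addrAC subrr add0r.
exact: (ideal_pow_sub Im).
Qed.

(** Completeness is given for [m]; the m-adic sum is also an a-adic one because each a^N is finitely
    generated. *)
Lemma adic_series_limit (c : nat -> R) :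
  (forall n, c n \in ideal_mem (ideal_pow a n)) ->
  exists s, forall N, s - \sum_(i < N) c i \in ideal_mem (ideal_pow a N).
Proof.
move=> cI; have am := proper_sub_max ha.
have [s hs] := series_limit am cI; exists s => N.
have [g gN Ng] := hR (ideal_pow a N).
(* The tail of the series is in a^N since its coefficients on generators of   *)
(* a^N converge.                                                              *)
have coef k : exists e : nat -> R, (forall i, e i \in ideal_mem (ideal_pow a k)) /\
    c (N + k)%N = \sum_(i < size g) e i * g`_i.
  apply: (ideal_powD_min (U := fun x => exists e : nat -> R,
    (forall i, e i \in ideal_mem (ideal_pow a k)) /\
    x = \sum_(i < size g) e i * g`_i) _ _ (cI _)).
    split.
      exists (fun=> 0); split=> [i|]; first exact: rpred0.
      by rewrite big1 // => i _; rewrite mul0r.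
    move=> b _ _ [e [he ->]] [f [hf ->]]; exists (fun i => b * e i + f i); split.
      by move=> i; rewrite rpredD // ideal_Ml.
    rewrite [_ *: _]mulr_sumr -big_split; apply: eq_bigr => i _.
    by rewrite /= mulrDl mulrA.
  move=> y z /Ng[d ->] zk; exists (fun i => d i * z); split.
    by move=> i; exact: (ideal_Ml (d i) zk).
  by rewrite mulr_suml; apply: eq_bigr => i _; rewrite mulrAC.
have [e he] := choice coef.
have lim i : exists E, forall K, E - \sum_(k < K) e k i \in ideal_mem (ideal_pow m K).
  exact: (series_limit am (c := fun k => e k i) (fun k => (he k).1 i)).
have [E hE] := choice lim.
have gm (b : nat -> R) : \sum_(i < size g) b i * g`_i \in ideal_mem (ideal_pow a N).
  by rewrite rpred_sum // => i _; apply: ideal_Ml; apply: gN; apply: mem_nth.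
suff -> : s - \sum_(i < N) c i = \sum_(i < size g) E i * g`_i by [].
(* By m-adic separation it suffices to compare both sides with their partial sums up to N + K,
   modulo m^K. *)
apply/eqP; rewrite -subr_eq0; apply/eqP; apply: hcompl.1 => K.
have -> : s - \sum_(i < N) c i - \sum_(i < size g) E i * g`_i =
    (s - \sum_(i < N + K) c i) - \sum_(i < size g) (E i - \sum_(k < K) e k i) * g`_i.
  rewrite big_split_ord /=.
  under [X in _ = _ - (_ + X) - _]eq_bigr => k _ do rewrite (he k).2.
  rewrite exchange_big /=; under [X in _ = _ - X]eq_bigr do rewrite mulrBl mulr_suml.
  by rewrite sumrB opprB opprD !addrA subrK.
rewrite rpredB //; last by rewrite rpred_sum // => i _; apply: ideal_Mr.
by apply: (@ideal_pow_le _ _ _ (N + K)); [rewrite leq_addl|apply: hs].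
Qed.

(** Coefficients on a finite generating family reduce the claim to series in [R]. *)
Lemma IM_complete (M : lmodType R) (u : nat -> M) : fin_gen M ->
  (forall n, in_IM (ideal_pow a n) (u n.+1 - u n)) ->
  exists x, forall n, in_IM (ideal_pow a n) (x - u n).
Proof.
move=> [t ht] hu.
have coef n : exists e : nat -> R, (forall i, e i \in ideal_mem (ideal_pow a n)) /\
    u n.+1 - u n = \sum_(i < size t) e i *: t`_i.
  by have [e he eE] := IM_span ht (hu n); exists e.
have [e he] := choice coef.
have lim i : exists E, forall N, E - \sum_(n < N) e n i \in ideal_mem (ideal_pow a N).
  exact: (adic_series_limit (c := fun k => e k i) (fun k => (he k).1 i)).
have [E hE] := choice lim.
exists (u 0%N + \sum_(i < size t) E i *: t`_i) => N.
have -> : u 0%N + \sum_(i < size t) E i *: t`_i - u N =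
    \sum_(i < size t) (E i - \sum_(n < N) e n i) *: t`_i.
  have -> : u N = u 0%N + \sum_(i < size t) (\sum_(n < N) e n i) *: t`_i.
    elim: N => [|N IH].
      by rewrite big1 ?addr0 // => i _; rewrite big_ord0 scale0r.
    rewrite -[LHS](subrK (u N)) (he N).2 IH addrCA; congr (_ + _).
    rewrite -big_split; apply: eq_bigr => i _.
    by rewrite big_ord_recr /= addrC scalerDl.
  rewrite opprD addrACA subrr add0r -sumrB; apply: eq_bigr => i _.
  by rewrite scalerBl.
apply: submod_sum => [|i _]; first exact: IM_submod.
by apply: IM_scale.
Qed.

End LocalRings.

(** * Flat modules and the graded pieces a^n/a^(n+1) *)

Section SubQuotient.
Variables (A : pzRingType) (V : lmodType A) (U : V -> Prop).

Definition submod_pred of is_submod U : {pred V} := fun x => `[< U x >].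

Variable hU : is_submod U.

Lemma submod_pred_closed : submod_closed (submod_pred hU).
Proof.
split=> [|c x y /asboolP Ux /asboolP Uy]; apply/asboolP; first exact: submod0.
exact: submodP.
Qed.
HB.instance Definition _ :=
  GRing.isSubmodClosed.Build A V (submod_pred hU) submod_pred_closed.

Record submod_type := SubmodType {
  submod_val : V;
  submod_valP : submod_val \in submod_pred hU
}.
HB.instance Definition _ := [isSub of submod_type for submod_val].
HB.instance Definition _ := [Choice of submod_type by <:].
HB.instance Definition _ := [SubChoice_isSubLmodule of submod_type by <:].

Lemma submod_val_linear : linear submod_val.
Proof. by []. Qed.
HB.instance Definition _ :=
  GRing.isLinear.Build A submod_type V _ submod_val submod_val_linear.

Definition submod_quot : zmodType := Quotient.quot (submod_pred hU).
Definition submod_proj (x : V) : submod_quot := \pi_(Quotient.quot (submod_pred hU)) x.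

Lemma submod_proj_zmod : zmod_morphism submod_proj.
Proof. by move=> x y; rewrite /submod_proj raddfB. Qed.
HB.instance Definition _ :=
  GRing.isZmodMorphism.Build V submod_quot submod_proj submod_proj_zmod.

Lemma submod_proj_eq x y : submod_proj x = submod_proj y <-> U (x - y).
Proof.
have -> : U (x - y) <-> x - y \in submod_pred hU by split=> /asboolP.
by rewrite Quotient.idealrBE; split=> [/eqP|/eqP].
Qed.

Lemma submod_proj_eq0 x : submod_proj x = 0 <-> U x.
Proof. by rewrite -(raddf0 submod_proj) submod_proj_eq subr0. Qed.

End SubQuotient.

Section Tensors.
Variables (A : Type) (M N : zmodType) (ra : M -> A -> M) (la : A -> N -> N).

Lemma tensor_of_eq0 s : tensor_of ra la s = 0 <->
  forall (G : zmodType) (b : M -> N -> G), balanced ra la b -> tensor_eval b s = 0.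
Proof.
have -> : 0 = tensor_of ra la [::] by [].
by rewrite tensor_ofP; split=> h G b /h; rewrite [tensor_eval b [::]]big_nil.
Qed.

Variables (G : zmodType) (b : M -> N -> G).
Hypothesis bb : balanced ra la b.

Lemma balanced0l n : b 0 n = 0.
Proof. by case: bb => bl _ _; apply: (addIr (b 0 n)); rewrite -bl !add0r. Qed.

Lemma balanced0r m : b m 0 = 0.
Proof. by case: bb => _ br _; apply: (addIr (b m 0)); rewrite -br !add0r. Qed.

Lemma balanced_suml (I : Type) (r : seq I) (P : pred I) (F : I -> M) n :
  b (\sum_(i <- r | P i) F i) n = \sum_(i <- r | P i) b (F i) n.
Proof.
by case: bb => bl _ _; rewrite (big_morph (b^~ n) (id1 := 0) (op1 := +%R)) ?balanced0l.
Qed.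

Lemma balanced_sumr (I : Type) (r : seq I) (P : pred I) (F : I -> N) m :
  b m (\sum_(i <- r | P i) F i) = \sum_(i <- r | P i) b m (F i).
Proof.
by case: bb => _ br _; rewrite (big_morph (b m) (id1 := 0) (op1 := +%R)) ?balanced0r.
Qed.

End Tensors.

Section TensorRMap.
Variables (R : comPzRingType) (M M' N N' : lmodType R).
Variables (f : {linear M -> M'}) (g : {linear N -> N'}).

Lemma tensorR_map_of (s : seq (M * N)) :
  tensorR_map f g (tensor_of _ _ s) = tensor_of _ _ [seq (f p.1, g p.2) | p <- s].
Proof. by apply: tensor_map_of => *; exact: linearZ_LR. Qed.

Lemma tensorR_map_zmod : zmod_morphism (tensorR_map f g).
Proof. by apply: tensor_map_zmod => *; exact: linearZ_LR. Qed.

HB.instance Definition _ := GRing.isZmodMorphism.Build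
  (tensorR M N) (tensorR M' N') (tensorR_map f g) tensorR_map_zmod.

End TensorRMap.

Section FlatRelations.
Variables (S : comPzRingType) (F : lmodType S) (k : nat) (r : 'I_k -> S).
Implicit Types (c : {ffun 'I_k -> S}).

Definition dotr c := \sum_j c j * r j.

Lemma dotrB c d : dotr (c - d) = dotr c - dotr d.
Proof. by rewrite /dotr -sumrB; apply: eq_bigr => j _; rewrite !ffunE mulrBl. Qed.

(** The trivial relations of the equational criterion for flatness: those induced by scalar
    relations among the [r j]. *)
Definition trivial_rel (x : {ffun 'I_k -> F}) :=
  exists2 s : seq ({ffun 'I_k -> S} * F), all (fun p => dotr p.1 == 0) s &
    x = [ffun j => \sum_(p <- s) p.1 j *: p.2].

Lemma trivial_rel_submod : is_submod trivial_rel.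
Proof.
split; first by exists [::] => //; apply/ffunP => j; rewrite !ffunE big_nil.
move=> d _ _ [s hs ->] [t ht ->].
exists ([seq (p.1, d *: p.2) | p <- s] ++ t).
  by rewrite all_cat all_map; apply/andP.
apply/ffunP => j; rewrite !ffunE big_cat big_map scaler_sumr; congr (_ + _).
by apply: eq_bigr => p _; rewrite !scalerA mulrC.
Qed.

Lemma trivial_rel1 c f : dotr c = 0 -> trivial_rel [ffun j => c j *: f].
Proof.
move=> hc; exists [:: (c, f)]; first by rewrite /= hc eqxx.
by apply/ffunP => j; rewrite !ffunE big_seq1.
Qed.

Lemma dotr_image_submod : is_submod (fun z : S^o => exists c, z = dotr c).
Proof.
split; first by exists 0; rewrite /dotr big1 // => j _; rewrite ffunE mul0r.
move=> d _ _ [c ->] [c' ->]; exists [ffun j => d * c j + c' j].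
rewrite [_ *: _]mulr_sumr -big_split; apply: eq_bigr => j _.
by rewrite ffunE mulrDl mulrA.
Qed.

(* For J the ideal generated by the r j, the hypothesis says that the element *)
(* sum x j (x) r j of F (x) J dies in F (x) S, hence is zero; the balanced    *)
(* map (f, dotr c) |-> (c j *: f)_j modulo trivial relations detects x.       *)
Lemma flat_trivial_rel (x : {ffun 'I_k -> F}) : flat F ->
  \sum_j r j *: x j = 0 -> trivial_rel x.
Proof.
move=> hF hx; pose J : lmodType S := submod_type dotr_image_submod.
pose e j : {ffun 'I_k -> S} := [ffun i => (i == j)%:R].
have dotr_e j : dotr (e j) = r j.
  rewrite /dotr (bigD1 j) //= ffunE eqxx mul1r big1 ?addr0 // => i ij.
  by rewrite ffunE (negPf ij) mul0r.
have eJ j : (r j : S^o) \in submod_pred dotr_image_submod.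
  by apply/asboolP; exists (e j).
pose rJ j : J := SubmodType (eJ j).
pose g : {linear J -> S^o} := @submod_val S S^o _ dotr_image_submod.
have gi : injective g by apply: val_inj.
pose t := [seq (x j, rJ j) | j <- enum 'I_k].
have t0 : (tensor_of _ _ t : tensorR F J) = 0.
  apply: (hF _ _ g gi); rewrite raddf0 tensorR_map_of; apply/tensor_of_eq0 => G b bb.
  rewrite /tensor_eval /t -map_comp big_map big_enum /=.
  transitivity (b (\sum_j r j *: x j) (1 : S)); last by rewrite hx (balanced0l bb).
  rewrite (balanced_suml bb); apply: eq_bigr => j _.
  by case: bb => _ _ ->; rewrite [_ *: _]mulr1.
(* [lift] is not additive, but its defects have [dotr] zero, so [b] below is balanced modulo trivial
   relations. *)
have /choice[lift hlift] (z : J) : exists c, g z = dotr c.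
  by have /asboolP := submod_valP z.
pose pi := submod_proj trivial_rel_submod.
pose b (f : F) (z : J) := pi [ffun j => lift z j *: f].
have bb : balanced (fun (m : F) (c : S) => c *: m) (fun (c : S) (n : J) => c *: n) b.
  split=> [f f' z|f z z'|f c z].
  - rewrite -raddfD; congr pi; apply/ffunP => j.
    by rewrite !ffunE scalerDr.
  - rewrite -raddfD; apply/submod_proj_eq.
    pose c := lift (z + z') - (lift z + lift z').
    rewrite (_ : _ - _ = [ffun j => c j *: f]).
      apply: trivial_rel1; apply/eqP; rewrite /dotr /c.
      under eq_bigr do rewrite !ffunE mulrBl mulrDl.
      by rewrite sumrB big_split /= -!/(dotr _) -!hlift linearD subrr.
    by apply/ffunP => j; rewrite !ffunE scalerBl scalerDl.
  - apply/submod_proj_eq.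
    pose d := [ffun j => lift z j * c] - lift (c *: z).
    rewrite (_ : _ - _ = [ffun j => d j *: f]).
      apply: trivial_rel1; apply/eqP; rewrite /dotr /d.
      under eq_bigr do rewrite !ffunE mulrBl mulrAC.
      rewrite sumrB /= -mulr_suml -!/(dotr _) -!hlift linearZ_LR.
      by rewrite [_ *: _]mulrC subrr.
    by apply/ffunP => j; rewrite !ffunE scalerBl scalerA.
have /tensor_of_eq0/(_ _ _ bb) := t0.
rewrite /tensor_eval /t big_map big_enum /= /b -raddf_sum => /submod_proj_eq0 h.
apply: (submodBK trivial_rel_submod _ h).
(* [x] is the sum of the e_i x_i, and [dotr] takes the same value [r i] on [e i] and on
   [lift (rJ i)], so each difference is a trivial relation. *)
have -> : x - \sum_i [ffun j => lift (rJ i) j *: x i] =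
  \sum_i [ffun j => (e i - lift (rJ i)) j *: x i].
  have {1}-> : x = \sum_i [ffun j => e i j *: x i].
    apply/ffunP => j; rewrite sum_ffunE (bigD1 j) //= !ffunE eqxx scale1r.
    by rewrite big1 ?addr0 // => i ij; rewrite !ffunE eq_sym (negPf ij) scale0r.
  rewrite -sumrB; apply: eq_bigr => i _; apply/ffunP => j.
  by rewrite !ffunE scalerBl.
apply: (submod_sum _ trivial_rel_submod) => i _; apply: trivial_rel1.
by rewrite dotrB dotr_e -hlift /= subrr.
Qed.

End FlatRelations.

Section FreeGradedPiece.
Variables (R : comPzRingType) (m a : ideal R) (n : nat).
Hypothesis hR : noetherian R.
Hypothesis hmax : maximal_ideal m.
Hypothesis huniq : forall m' : ideal R, maximal_ideal m' -> ideal_mem m' =i ideal_mem m.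
Hypothesis ha : is_proper a.
Hypothesis hflat : flat (gr a n : lmodType (quotring a)).

Let S n := ideal_mem (ideal_pow a n).

(** Generation of a^n/a^(n+1), stated on representatives in [R] so that it applies inside any
    R-module. *)
Definition gr_generates k (x : 'I_k -> R) := (forall j, x j \in S n) /\
  forall c, c \in S n -> exists r : 'I_k -> R, c - \sum_j r j * x j \in S n.+1.

Lemma gr_generates_exists : exists k, exists x : 'I_k -> R, gr_generates x.
Proof.
have [s sI Is] := hR (ideal_pow a n).
exists (size s), (fun j => s`_j); split=> [j|c /Is[d ->]].
  by apply: sI; apply: mem_nth.
by exists d; rewrite subrr rpred0.
Qed.

(** A generator whose coefficient in a relation is a unit can be eliminated. *)
Lemma gr_generates_lift k (x : 'I_k.+1 -> R) (r : 'I_k.+1 -> R) j :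
  gr_generates x -> \sum_j r j * x j \in S n.+1 -> r j \notin ideal_mem m ->
  gr_generates (x \o lift j).
Proof.
move=> [xn hx] hr rj; split=> [i|c cn]; first exact: xn.
have [u ur] := local_inv hR huniq rj.
have [d hd] := hx c cn.
exists (fun i => d (lift j i) - d j * u * r (lift j i)).
suff -> : c - \sum_i (d (lift j i) - d j * u * r (lift j i)) * (x \o lift j) i =
    (c - \sum_i d i * x i) + d j * u * \sum_i r i * x i.
  by rewrite rpredD // ideal_Ml.
rewrite (bigD1_ord (P := predT) j) //=.
rewrite [\sum_(i < k.+1) r i * x i](bigD1_ord (P := predT) j) //=.
under eq_bigr do rewrite mulrBl -(mulrA (d j * u)).
rewrite sumrB -mulr_sumr mulrDr (mulrA _ (r j)) -(mulrA (d j) u (r j)) ur mulr1 opprB.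
set q := d j * x j; set D := \sum_(i < k) _ * _; set X := _ * \sum_(i < k) _.
by rewrite opprD -[RHS]addrA; congr (_ + _); rewrite addrACA addNr add0r addrC.
Qed.

Lemma gr_minimal_indep k (x : 'I_k -> R) c : gr_generates x ->
  (forall k' (y : 'I_k' -> R), gr_generates y -> (k <= k')%N) ->
  \sum_j c j * x j \in S n.+1 -> forall j, c j \in ideal_mem m.
Proof.
case: k x c => [|k] x c hx kmin hc j; first by case: j.
apply: contrapT => /negP cj.
by have := kmin _ _ (gr_generates_lift hx hc cj); rewrite ltnn.
Qed.

(** Take a minimal generating system. By flatness a relation [r] is trivial; rewriting its witnesses
    in terms of the [x j] gives a matrix [M] with x = M x modulo a^(n+1) and r M = 0 modulo a.
    Minimality makes [M] the identity modulo m, so its determinant is a unit and [r] vanishes modulo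
    a. *)
Lemma gr_basis_exists : exists k, exists x : 'I_k -> R, gr_generates x /\
  forall r, \sum_j r j * x j \in S n.+1 -> forall j, r j \in ideal_mem a.
Proof.
have ex : exists k, `[< exists x : 'I_k -> R, gr_generates x >].
  by have [k h] := gr_generates_exists; exists k; apply/asboolP.
case: (ex_minnP ex) => k /asboolP[x hx] kmin; exists k, x; split=> // r hr.
have indep c := @gr_minimal_indep _ x c hx
  (fun k' y hy => kmin k' (introT (asboolP _) (ex_intro _ y hy))).
have [xn gen] := hx.
pose xb j : gr a n := gr_proj (IdealSub (xn j)).
have comb (c : 'I_k -> R) (y : ideal_sub a n) : gr_proj y = \sum_j qproj a (c j) *: xb j <->
    ideal_val y - \sum_j c j * x j \in S n.+1.
  pose z := \sum_j ideal_scale (c j) (IdealSub (xn j)).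
  have -> : \sum_j qproj a (c j) *: xb j = gr_proj z.
    by rewrite raddf_sum; apply: eq_bigr => j _; exact: gr_scale_proj.
  by rewrite gr_proj_eq raddf_sum.
have /= hrel := @flat_trivial_rel _ _ k (fun j => qproj a (r j)) [ffun j => xb j] hflat.
have [|s hs xE] := hrel.
  under eq_bigr do rewrite ffunE.
  transitivity (gr_proj 0 : gr a n); last exact: raddf0.
  by apply/esym/comb; rewrite raddf0 sub0r rpredN.
have /choice[b hb] (f : gr a n) : exists b : 'I_k -> R, f = \sum_j qproj a (b j) *: xb j.
  rewrite -[f]gr_reprK; have [b hb] := gen _ (ideal_valP (gr_repr f)).
  by exists b; apply/comb.
pose M := \matrix_(j < k, i < k) \sum_(p <- s) qrepr (p.1 j) * b p.2 i.
have M1 : map_mx (qproj m) M = 1%:M.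
  apply/matrixP => j i; rewrite !mxE -(rmorph_nat (qproj m)); apply/esym/qproj_eq.
  move: i; apply: (indep (fun i => (j == i)%:R - \sum_(p <- s) qrepr (p.1 j) * b p.2 i)).
  have /comb : xb j = \sum_i qproj a (M j i) *: xb i.
    have := congr1 (fun h : {ffun 'I_k -> gr a n} => h j) xE; rewrite !ffunE => ->.
    under [RHS]eq_bigr do rewrite mxE (raddf_sum (qproj a)) scaler_suml.
    rewrite exchange_big; apply: eq_bigr => p _; rewrite {1}(hb p.2) scaler_sumr.
    apply: eq_bigr => i _; rewrite scalerA -{1}[p.1 j]qreprK.
    by congr (_ *: _); exact/esym/(rmorphM (qproj a)).
  suff -> : \sum_i ((j == i)%:R - \sum_(p <- s) qrepr (p.1 j) * b p.2 i) * x i =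
    x j - \sum_i M j i * x i by [].
  under eq_bigr do rewrite mulrBl.
  rewrite sumrB (bigD1 j (P := predT)) //= eqxx mul1r big1 ?addr0 => [|i ij].
    by under [in RHS]eq_bigr do rewrite mxE.
  by rewrite eq_sym (negPf ij) mul0r.
have detm : \det M \notin ideal_mem m.
  apply: contra (max_proper hmax) => dm.
  have : qproj m 1 = qproj m 0.
    rewrite rmorph1 -(det1 _ k) -M1 det_map_mx; apply/qproj_eq.
    by rewrite subr0.
  by move/qproj_eq; rewrite subr0.
have [u ud] := local_inv hR huniq detm.
have rM i : \sum_j r j * M j i \in ideal_mem a.
  under eq_bigr do rewrite mxE mulr_sumr.
  rewrite exchange_big big_seq rpred_sum // => p /(allP hs) /eqP hp /=.
  under eq_bigr do rewrite mulrA.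
  rewrite -mulr_suml ideal_Mr // -[X in X \in _]subr0; apply/qproj_eq.
  rewrite raddf0 raddf_sum -[RHS]hp; apply: eq_bigr => j _.
  by rewrite -{2}[p.1 j]qreprK mulrC; exact: (rmorphM (qproj a)).
move=> j; rewrite -[r j]mul1r -ud -mulrA ideal_Ml //.
pose v : 'rV[R]_k := \row_i r i.
have -> : \det M * r j = (v *m M *m \adj M) 0 j.
  by rewrite -mulmxA mul_mx_adj mul_mx_scalar !mxE.
rewrite mxE rpred_sum // => i _; apply: ideal_Mr; rewrite mxE.
by under eq_bigr do rewrite mxE.
Qed.

End FreeGradedPiece.

(** * Tor vanishing *)

Section FiniteSupport.
Variables (R : comPzRingType) (P : lmodType R).

Definition finite_support (f : P -> R^o) := exists l : seq P, forall t, t \notin l -> f t = 0.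

Lemma finite_support_submod : is_submod (finite_support : (P -> R^o)%type -> Prop).
Proof.
split; first by exists [::].
move=> c f g [l hl] [l' hl']; exists (l ++ l') => t; rewrite mem_cat negb_or.
by move=> /andP[/hl ft /hl' gt]; rewrite [LHS]/(c * f t + g t) ft gt mulr0; exact: addr0.
Qed.

(** The free module on the underlying set of [P]; its canonical surjection [free_eval] splits when
    [P] is projective. *)
Definition free_mod : lmodType R := submod_type finite_support_submod.

Definition free_coord (f : free_mod) : P -> R := submod_val f.

Lemma free_support_exists (f : free_mod) :
  exists l : seq P, uniq l /\ forall t, t \notin l -> free_coord f t = 0.
Proof.
have /asboolP[l hl] := submod_valP f; exists (undup l); split; first exact: undup_uniq.
by move=> t; rewrite mem_undup; apply: hl.
Qed.

Definition free_eval (f : free_mod) : P :=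
  \sum_(t <- sval (cid (free_support_exists f))) free_coord f t *: t.

Lemma free_evalE (f : free_mod) (l : seq P) : uniq l ->
  (forall t, t \notin l -> free_coord f t = 0) ->
  free_eval f = \sum_(t <- l) free_coord f t *: t.
Proof.
move=> lu hl; rewrite /free_eval; case: cid => l' /= [lu' hl'].
have red (s : seq P) : \sum_(t <- s) free_coord f t *: t =
    \sum_(t <- [seq t <- s | free_coord f t != 0]) free_coord f t *: t.
  rewrite big_filter [RHS]big_mkcond; apply: eq_bigr => t _.
  by case: eqVneq => //= ->; rewrite scale0r.
rewrite red [RHS]red; apply: perm_big; apply: uniq_perm; rewrite ?filter_uniq //.
move=> t; rewrite !mem_filter; case: (eqVneq (free_coord f t) 0) => //= ft.
have -> : t \in l by apply: contraNT ft => /hl ->.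
by apply: contraNT ft => /hl' ->.
Qed.

Lemma free_coordP c (f g : free_mod) t :
  free_coord (c *: f + g) t = c * free_coord f t + free_coord g t.
Proof. by []. Qed.

Lemma free_eval_linear : linear free_eval.
Proof.
move=> c f g; have [l [lu hl]] := free_support_exists f.
have [l' [lu' hl']] := free_support_exists g.
pose s := undup (l ++ l').
have su : uniq s by apply: undup_uniq.
have sf t : t \notin s -> free_coord f t = 0.
  by rewrite mem_undup mem_cat negb_or => /andP[/hl].
have sg t : t \notin s -> free_coord g t = 0.
  by rewrite mem_undup mem_cat negb_or => /andP[_ /hl'].
rewrite (free_evalE su sf) (free_evalE su sg) (@free_evalE _ s) //.
  rewrite scaler_sumr -big_split; apply: eq_bigr => t _.
  by rewrite free_coordP scalerDl scalerA.
by move=> t ts; rewrite free_coordP sf // sg // mulr0 addr0.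
Qed.
HB.instance Definition _ := GRing.isLinear.Build R free_mod P _ free_eval free_eval_linear.

Lemma free_eval_surj p : exists f, free_eval f = p.
Proof.
pose d (t : P) : R^o := (t == p)%:R.
have dP : (d : (P -> R^o)%type) \in submod_pred finite_support_submod.
  by apply/asboolP; exists [:: p] => t; rewrite inE /d => /negPf ->.
exists (SubmodType dP); rewrite (@free_evalE _ [:: p]) //.
  by rewrite big_seq1 /free_coord /= /d eqxx scale1r.
by move=> t; rewrite inE /free_coord /= /d => /negPf ->.
Qed.

Lemma projective_dual_basis : projective P ->
  exists2 h : P -> P -> R, forall t, linear (h^~ t : P -> R^o) &
    forall p, exists l, p = \sum_(t <- l) h p t *: t.
Proof.
move=> hP; have [h hE] := hP free_mod P (free_eval : {linear _ -> _}) idfun free_eval_surj.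
exists (fun p t => free_coord (h p) t) => [t c x y|p].
  by rewrite linearP free_coordP.
by exists (sval (cid (free_support_exists (h p)))); rewrite -{1}[p]hE.
Qed.

(** Each coordinate functional of a dual basis carries the relation into [R], where independence
    puts the coordinates of [p j] in a. *)
Lemma projective_indep (a J : ideal R) k (x : 'I_k -> R) (p : 'I_k -> P) : projective P ->
  (forall r : 'I_k -> R, \sum_j r j * x j \in ideal_mem J -> forall j, r j \in ideal_mem a) ->
  in_IM J (\sum_j x j *: p j) -> forall j, in_IM a (p j).
Proof.
move=> /projective_dual_basis[h hlin hbasis] indep hp j.
have [l ->] := hbasis (p j); apply: submod_sum => [|t _]; first exact: IM_submod.
apply: IM_scale; move: j; apply: indep.
pose ht := HB.pack_for {linear P -> R^o} (h^~ t : P -> R^o)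
  (GRing.isLinear.Build R P R^o _ (h^~ t : P -> R^o) (hlin t)).
have /IM_regular := IM_linear ht hp.
by rewrite linear_sum; under eq_bigr do rewrite linearZ_LR [_ *: _]mulrC.
Qed.

End FiniteSupport.

Section TensorQuotient.
Variables (R : comPzRingType) (M : lmodType R) (I : ideal R).

Definition tens1 (x : M) : tensorR M (quotring I) := tensor_of _ _ [:: (x, 1)].

Lemma tens1_surj (t : tensorR M (quotring I)) : exists x, t = tens1 x.
Proof.
rewrite -[t]tensor_reprK; set s := tensor_repr t.
exists (\sum_(p <- s) qrepr p.2 *: p.1); apply/tensor_ofP => G b bb.
rewrite /tensor_eval big_seq1 /= (balanced_suml bb); apply: eq_bigr => p _.
case: bb => _ _ ->; congr b; rewrite -{1}[p.2]qreprK.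
by rewrite [RHS]mulr1.
Qed.

(** With [tens1_surj] this is the isomorphism of M/IM with M (x) R/I; its inverse is induced by the
    balanced map sending (y, q) to the class of [qrepr q *: y]. *)
Lemma tens1_eq0 x : tens1 x = 0 <-> in_IM I x.
Proof.
split=> [/tensor_of_eq0 h|].
  have qIM c d (y : M) : c - d \in ideal_mem I ->
      submod_proj (@IM_submod _ M I) (c *: y) =
      submod_proj (@IM_submod _ M I) (d *: y).
    by move=> cd; apply/submod_proj_eq; rewrite -scalerBl; apply: IM_scale.
  have bb : balanced (fun (m : M) (c : R) => c *: m)
      (fun (c : R) (n : quotring I) => c *: n)
      (fun y q => submod_proj (@IM_submod _ M I) (qrepr q *: y)).
    split=> [y y' q|y q q'|y c q].
    - by rewrite scalerDr; exact: raddfD.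
    - rewrite -raddfD -scalerDl; apply/qIM/qproj_eq.
      rewrite qreprK -{1}[q]qreprK -{1}[q']qreprK; exact/esym/(raddfD (qproj I)).
    - rewrite scalerA; apply/qIM/qproj_eq.
      by rewrite qreprK -{2}[q]qreprK mulrC; exact: (rmorphM (qproj I)).
  have := h _ _ bb; rewrite /tensor_eval big_seq1 /= => x0.
  apply/(submod_proj_eq0 (IM_submod I)); rewrite -x0 -[x in submod_proj _ x]scale1r.
  by apply/qIM/qproj_eq; rewrite qreprK.
move=> [s hs ->]; apply/tensor_of_eq0 => G b bb.
rewrite /tensor_eval big_seq1 /= (balanced_suml bb) big_seq big1 // => p /(allP hs) pI.
have [_ _ ->] := bb; rewrite [_ *: _](_ : _ = 0) ?(balanced0r bb) //.
rewrite [LHS]mulr1 -(raddf0 (qproj I)); apply/qproj_eq; by rewrite subr0.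
Qed.

End TensorQuotient.

Lemma linear_comb (R : pzRingType) (M N : lmodType R) (f : {linear M -> N})
    (I : finType) (c : I -> R) (x : I -> M) :
  f (\sum_j c j *: x j) = \sum_j c j *: f (x j).
Proof. by rewrite linear_sum; apply: eq_bigr => j _; rewrite linearZ_LR. Qed.

Section TorVanishing.
Variables (R : comPzRingType) (M : lmodType R) (P : proj_resolution M).
Variable a : ideal R.

Lemma pr_dd i (y : P i.+2) : pr_d P i (pr_d P i.+1 y) = 0.
Proof. by apply/pr_exact; exists y. Qed.

Lemma pr_aug_d (y : P 1%N) : pr_aug P (pr_d P 0 y) = 0.
Proof. by apply/pr_exact0; exists y. Qed.

(** Exactness of P (x) R/I in degree i + 1, that is, the vanishing of Tor_(i+1), freed of
    tensors. *)
Definition exact_mod (I : ideal R) i := forall x : P i.+1,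
  in_IM I (pr_d P i x) -> exists y, in_IM I (x - pr_d P i.+1 y).

Lemma tensorR_map_tens1 i (I : ideal R) x :
  tensorR_map (pr_d P i) (idfun : {linear quotring I -> quotring I}) (tens1 I x) =
  tens1 I (pr_d P i x).
Proof. exact: tensorR_map_of. Qed.

Lemma tens1B (N : lmodType R) (I : ideal R) (x y : N) :
  tens1 I (x - y) = tens1 I x - tens1 I y.
Proof.
apply/eqP; rewrite eq_sym subr_eq; apply/eqP; rewrite -tensor_of_cat.
apply/tensor_ofP => G b [bl _ _].
by rewrite /tensor_eval /= !big_cons !big_nil /= !addr0 -bl subrK.
Qed.

Lemma exact_modP (I : ideal R) i :
  (forall t : tensorR (P i.+1) (quotring I), tor_cycle t ->
     exists u : tensorR (P i.+2) (quotring I),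
       t = tensorR_map (pr_d P i.+1) (idfun : {linear quotring I -> quotring I}) u) <->
  exact_mod I i.
Proof.
split=> [h x dx|h t].
  have [|u] := h (tens1 I x); first by rewrite /tor_cycle tensorR_map_tens1; apply/tens1_eq0.
  have [y ->] := tens1_surj u; rewrite tensorR_map_tens1 => xy.
  by exists y; apply/tens1_eq0; rewrite tens1B xy subrr.
have [x ->] := tens1_surj t.
rewrite /tor_cycle tensorR_map_tens1 => /tens1_eq0/h[y /tens1_eq0].
rewrite tens1B => /eqP; rewrite subr_eq0 => /eqP ->.
by exists (tens1 I y); rewrite tensorR_map_tens1.
Qed.

Lemma IM_powS (N : lmodType R) n c (x : N) : c \in ideal_mem (ideal_pow a n) ->
  in_IM a x -> in_IM (ideal_pow a n.+1) (c *: x).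
Proof.
move=> cn xa; apply: IM_sub (IM_mul cn xa) => y.
apply: (ideal_mul_min (ideal_submod _)) => u v ua vn.
by rewrite mulrC; apply: ideal_mul_mem.
Qed.

Lemma IM_gr_generates (N : lmodType R) n k (x : 'I_k -> R) (y : N) :
  gr_generates a n x -> in_IM (ideal_pow a n) y ->
  exists p : 'I_k -> N, in_IM (ideal_pow a n.+1) (y - \sum_j x j *: p j).
Proof.
move=> [xn gen]; apply: (IM_min (U := fun y => exists p : 'I_k -> N,
  in_IM (ideal_pow a n.+1) (y - \sum_j x j *: p j))) => [|c z /gen[r hr]].
  split.
    exists (fun=> 0); rewrite big1 ?subrr => [|j _]; last by rewrite scaler0.
    exact: (submod0 (IM_submod _)).
  move=> c u v [p hp] [q hq]; exists (fun j => c *: p j + q j).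
  rewrite (_ : _ - _ = c *: (u - \sum_j x j *: p j) + (v - \sum_j x j *: q j)).
    exact: (submodP _ (IM_submod _)).
  rewrite scalerBr addrACA -opprD; congr (_ - _).
  rewrite scaler_sumr -big_split; apply: eq_bigr => j _.
  by rewrite scalerDr !scalerA mulrC.
exists (fun j => r j *: z).
have -> : \sum_j x j *: (r j *: z) = (\sum_j r j * x j) *: z.
  by rewrite scaler_suml; apply: eq_bigr => j _; rewrite scalerA mulrC.
by rewrite -scalerBl; apply: IM_scale.
Qed.

Section Step.
Variables (n k : nat) (x : 'I_k -> R).
Hypothesis gen : gr_generates a n x.
Hypothesis indep : forall r : 'I_k -> R,
  \sum_j r j * x j \in ideal_mem (ideal_pow a n.+1) -> forall j, r j \in ideal_mem a.

(** A cycle modulo a^(n+1) is a boundary modulo a^n, with an error sum x_j p_j modulo a^(n+1).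
    Independence makes the p_j cycles modulo a, hence boundaries modulo a, and the error is
    absorbed. *)
Lemma exact_mod_powS i :
  exact_mod a i -> exact_mod (ideal_pow a n) i -> exact_mod (ideal_pow a n.+1) i.
Proof.
move=> ha hn z dz.
have [|y hy] := hn z; first by apply: IM_sub dz; apply: ideal_powS_sub.
have [p hp] := IM_gr_generates gen hy.
have hdp j : in_IM a (pr_d P i (p j)).
  move: j; apply: (projective_indep (p := fun j => pr_d P i (p j)) (@pr_projective _ _ P i) indep).
  have := IM_linear (pr_d P i) hp; rewrite linearB linearB /= pr_dd subr0 linear_comb.
  move/(submodB (IM_submod _) dz); rewrite opprB addrC subrK.
  by [].
have /choice[q hq] j := ha _ (hdp j).
exists (y + \sum_j x j *: q j).
rewrite (_ : _ - _ = (z - pr_d P i.+1 y - \sum_j x j *: p j) +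
  \sum_j x j *: (p j - pr_d P i.+1 (q j))).
  apply: (submodD (IM_submod _)) => //; apply: (submod_sum _ (IM_submod _)) => j _.
  by apply: IM_powS => //; case: gen.
under [X in _ = _ + X]eq_bigr do rewrite scalerBr.
by rewrite sumrB linearD linear_comb /= opprD !addrA subrK.
Qed.

(** Lifted to [P 0], the relation is an element of a^(n+1) P_0 plus a boundary d q. Exactness modulo
    a^n lets q be replaced by sum x_j w_j modulo a^(n+1), and independence over the projective P_0
    applies to p_j - d w_j. *)
Lemma gr_indep_module (l : 'I_k -> M) : exact_mod a 0 -> exact_mod (ideal_pow a n) 0 ->
  in_IM (ideal_pow a n.+1) (\sum_j x j *: l j) -> forall j, in_IM a (l j).
Proof.
move=> ha hn hl.
have /choice[p hp] j := @pr_aug_surj _ _ P (l j).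
have [z hz zE] := IM_linear_lift (@pr_aug_surj _ _ P) hl.
have [q hq] : exists q, \sum_j x j *: p j - z = pr_d P 0 q.
  apply/pr_exact0; rewrite linearB /= zE linear_comb.
  by under eq_bigr do rewrite hp; rewrite subrr.
have dq : in_IM (ideal_pow a n) (pr_d P 0 q).
  rewrite -hq; apply: (submodB (IM_submod _)).
    by apply: (submod_sum _ (IM_submod _)) => j _; apply: IM_scale; case: gen.
  by apply: IM_sub hz; apply: ideal_powS_sub.
have [y hy] := hn _ dq.
have [w hw] := IM_gr_generates gen hy.
have dwE : pr_d P 0 (q - pr_d P 1 y) = pr_d P 0 q by rewrite linearB /= pr_dd subr0.
have hpw : forall j, in_IM a (p j - pr_d P 0 (w j)).
  apply: (projective_indep (p := fun j => p j - pr_d P 0 (w j)) (@pr_projective _ _ P 0) indep).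
  rewrite (_ : \sum_j _ = z + pr_d P 0 (q - pr_d P 1 y - \sum_j x j *: w j)).
    by apply: (submodD (IM_submod _)) => //; apply: IM_linear.
  under eq_bigr do rewrite scalerBr.
  by rewrite [in RHS]linearB /= dwE -hq linear_comb sumrB addrA [z + _]addrC subrK.
by move=> j; rewrite -(hp j); have := IM_linear (pr_aug P) (hpw j);
  rewrite linearB /= pr_aug_d subr0.
Qed.

End Step.
End TorVanishing.

(** * Homotopies and free resolutions *)

(** Lets a family run over all degrees when only one member matters, which avoids transport along
    equalities of degrees. *)
Lemma dep_extend (I : Type) (B : I -> Type) (d : forall i, B i) i (b : B i) :
  exists f : forall i, B i, f i = b /\ forall j, j <> i -> f j = d j.
Proof.
exists (fun j => match pselect (i = j) with
  | left e => eq_rect i B b j e | right _ => d j end); split=> [|j ji].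
  by case: pselect => // e; rewrite (Prop_irrelevance e erefl).
by case: pselect => // e; case: ji.
Qed.

Lemma dep_extend2 (B : int -> int -> Type) (d : forall i j, B i j) i j (b : B i j) :
  exists f : forall i j, B i j, f i j = b.
Proof.
have [f [fE _]] := @dep_extend _ (fun ij => B ij.1 ij.2) (fun ij => d ij.1 ij.2) (i, j) b.
by exists (fun i j => f (i, j)).
Qed.

(** Descending recursion on degrees: [t0] above [n], then one step per degree, with [Good] as the
    invariant. *)
Lemma int_down_choice (T : Type) (Good : int -> T -> Prop)
    (Rel : int -> T -> T -> Prop) (t0 : T) (n : int) :
  (forall i, n < i -> Good i t0 /\ Rel i t0 t0) ->
  (forall i t, i <= n -> Good (i + 1) t -> exists t', Good i t' /\ Rel i t t') ->
  exists f : int -> T, forall i, Rel i (f (i + 1)) (f i).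
Proof.
move=> top step.
have /choice[st hst] (it : int * T) : exists t', it.1 <= n -> Good (it.1 + 1) it.2 ->
    Good it.1 t' /\ Rel it.1 it.2 t'.
  have [h|h] := pselect (it.1 <= n /\ Good (it.1 + 1) it.2).
    by have [t' ht'] := step _ _ h.1 h.2; exists t'.
  by exists t0 => h1 h2; case: h.
(* [S k] is the state in degree n + 1 - k; [kappa] below sends all degrees above [n] to k = 0. *)
pose fix S k := if k is k'.+1 then st (n - k'%:Z, S k') else t0.
have SG k : Good (n - k%:Z + 1) (S k).
  elim: k => [|k IH]; first by rewrite subr0; apply: (top _ _).1; rewrite ltrDl.
  have -> : n - k.+1%:Z + 1 = n - k%:Z by rewrite -addn1 PoszD opprD addrA subrK.
  by apply: (hst (n - k%:Z, S k) _ IH).1; rewrite /= gerBl.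
pose kappa (z : int) := if z is Posz k then k else 0%N.
exists (fun i => S (kappa (n + 1 - i))) => i.
rewrite opprD addrACA subrr addr0.
have [ni|] := ltP n i.
  have [k nk] : exists k, n - i = Negz k.
    by case: (n - i) (subr_lt0 i n) => [k|k _]; [rewrite ni|exists k].
  have -> : kappa (n + 1 - i) = 0%N.
    by rewrite addrAC nk NegzE -addn1 PoszD opprD subrK; case: (k).
  by rewrite nk; case: (top i ni).
rewrite -subr_ge0; case e: (n - i) => [k|//] _.
have -> : i = n - k%:Z by rewrite -e subKr.
have -> : n + 1 - (n - k%:Z) = k.+1%:Z by rewrite opprB addrCA addrAC subrr add0r -addn1 PoszD.
by apply: (hst (n - k%:Z, S k) _ (SG k)).2; rewrite /= gerBl.
Qed.

(** * Maps from bounded above free complexes to acyclic cones *)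

Section Complexes.
Variables (A : pzRingType).

Lemma coboundaryE (P : complex A) i j (x : P j) : j = i + 1 ->
  coboundary x <-> exists y : P i, x = cd P i j y.
Proof. by move=> e; move: x; rewrite e => x; rewrite /coboundary addrK. Qed.

Section Lift.
Variables (X Y : complex A) (g : chain_map X Y).
Hypothesis gq : quasi_iso g.

(** Exactness of the mapping cone: injectivity of H^(j+1)(g) gives a primitive of [a], and
    surjectivity of H^j(g) corrects it by a cocycle. *)
Lemma quasi_iso_cone j (a : X (j + 1)) (b : Y j) :
  cd X (j + 1) (j + 1 + 1) a = 0 -> g (j + 1) a = cd Y j (j + 1) b ->
  exists x' (y' : Y (j - 1)), cd X j (j + 1) x' = a /\ b = g j x' + cd Y (j - 1) j y'.
Proof.
move=> ac gab; have [inj _] := gq (j + 1); have [_ surj] := gq j.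
have /(coboundaryE _ (erefl (j + 1)))[x0 ax0] : coboundary a.
  by apply: inj => //; apply/(coboundaryE _ (erefl (j + 1))); exists b.
have [|x1 x1c [y hy]] := surj (b - g j x0).
  by rewrite /cocycle linearB /= -cm_comm -ax0 gab subrr.
exists (x0 + x1), y; split; first by rewrite linearD /= x1c addr0.
by rewrite -hy linearD /= -[b - _ - _]addrA -opprD addrCA subrr addr0.
Qed.

Variables (r : int -> nat) (n p : int).
Hypothesis rn : forall i, n < i -> r i = 0%N.
Variable D : forall i j, 'M[A]_(r i, r j).
Hypothesis DD : forall i j k, D i j *m D j k = 0.
Variables (u : forall i j, {linear 'rV[A]_(r i) -> X j}).
Variables (v : forall i j, {linear 'rV[A]_(r i) -> Y j}).
Hypothesis hu : forall i j x, j = i + p + 1 ->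
  cd X j (j + 1) (u i j x) = - u (i + 1) (j + 1) (x *m D i (i + 1)).
Hypothesis hv : forall i j x, j = i + p ->
  g (j + 1) (u i (j + 1) x) = cd Y j (j + 1) (v i j x) - v (i + 1) (j + 1) (x *m D i (i + 1)).

(* (u, v) is a chain map to the acyclic cone of g, hence null-homotopic.      *)
Lemma lift_to_cone :
  exists (s : forall i j, {linear 'rV[A]_(r i) -> X j})
         (t : forall i j, {linear 'rV[A]_(r i) -> Y j}),
  forall i j x, j = i + p ->
    u i (j + 1) x = cd X j (j + 1) (s i j x) - s (i + 1) (j + 1) (x *m D i (i + 1)) /\
    v i j x = g j (s i j x) + cd Y (j - 1) j (t i (j - 1) x) + t (i + 1) j (x *m D i (i + 1)).
Proof.
pose T := ((forall i j, {linear 'rV[A]_(r i) -> X j}) *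
           (forall i j, {linear 'rV[A]_(r i) -> Y j}))%type.
(* The invariant is the homotopy identity restricted to the kernel of [D], where the term from
   degree i + 1 disappears. *)
pose Good i (w : T) := forall j x, j = i + p -> x *m D i (i + 1) = 0 ->
  cd X j (j + 1) (w.1 i j x) = u i (j + 1) x /\
  v i j x = g j (w.1 i j x) + cd Y (j - 1) j (w.2 i (j - 1) x).
pose Rel i (w w' : T) := forall j x, j = i + p ->
    u i (j + 1) x = cd X j (j + 1) (w'.1 i j x) - w.1 (i + 1) (j + 1) (x *m D i (i + 1)) /\
    v i j x = g j (w'.1 i j x) + cd Y (j - 1) j (w'.2 i (j - 1) x) +
      w.2 (i + 1) j (x *m D i (i + 1)).
have RelGood i w w' : Rel i w w' -> Good i w'.
  move=> h j x /h-/(_ x)[h1 h2] xD; rewrite h1 h2 xD.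
  by split; rewrite linear0 ?subr0 ?addr0.
pose t0 : T := (fun i j => (\0 : {linear 'rV[A]_(r i) -> X j}),
                fun i j => (\0 : {linear 'rV[A]_(r i) -> Y j})).
have [i ni|i w _ Gw|f hf] := @int_down_choice T Good Rel t0 n.
- have x0 (x : 'rV[A]_(r i)) : x = 0.
    by apply/rowP => j; case: j (j) => k hk; rewrite rn in hk.
  suff h : Rel i t0 t0 by split=> //; apply: RelGood h.
  by move=> j x _; rewrite (x0 x) mul0mx; split; rewrite !linear0 ?addr0 ?subr0.
- pose q := i + p.
  pose Q x (y : (X q * Y (q - 1))%type) :=
    u i (q + 1) x = cd X q (q + 1) y.1 - w.1 (i + 1) (q + 1) (x *m D i (i + 1)) /\
    v i q x = g q y.1 + cd Y (q - 1) q y.2 + w.2 (i + 1) q (x *m D i (i + 1)).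
  have [c x y z t [h1 h2] [h3 h4]|x|h hh] := @row_choice A (r i) _ Q.
  + split; rewrite mulmxDl -scalemxAl !linearP ?h1 ?h2 ?h3 ?h4 /= ?linearP.
      by rewrite scalerDr addrACA.
    by rewrite !scalerDr addrACA; congr (_ + _); rewrite addrACA.
  (* [z] is killed by the next differential, so the invariant holds at [z] and makes the corrected
     pair a cocycle of the cone. *)
  + set z := x *m D i (i + 1).
    have [||e1 e2] := Gw (q + 1) z; [exact: addrAC|by rewrite -mulmxA DD mulmx0|].
    rewrite addrK in e2.
    have [||x' [y' [hx' hy']]] := @quasi_iso_cone q
      (u i (q + 1) x + w.1 (i + 1) (q + 1) z) (v i q x - w.2 (i + 1) q z).
    - by rewrite linearD /= (hu _ (erefl _)) e1 addNr.
    - rewrite !linearD linearN /= (hv _ (erefl _)) e2 -/z.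
      by rewrite opprD addrA addrAC subrK.
    exists (x', y'); rewrite /Q /= -/z hx' -hy'.
    by rewrite addrK subrK.
  have [s sE] := dep_extend2 (B := fun i j => {linear 'rV[A]_(r i) -> X j})
    t0.1 (fst \o h : {linear _ -> _}).
  have [t tE] := dep_extend2 (B := fun i j => {linear 'rV[A]_(r i) -> Y j})
    t0.2 (snd \o h : {linear _ -> _}).
  have Relst : Rel i w (s, t) by move=> j x ->; rewrite /= sE tE; exact: hh.
  by exists (s, t); split=> //; apply: RelGood Relst.
exists (fun i => (f i).1 i), (fun i => (f i).2 i) => i j x ji.
exact: hf.
Qed.

End Lift.
End Complexes.

Lemma rV_mul_inj (A : pzRingType) m n (M N : 'M[A]_(m, n)) :
  (forall x : 'rV_m, x *m M = x *m N) -> M = N.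
Proof. by move=> h; apply/row_matrixP => i; rewrite !rowE h. Qed.

Section MatrixComplex.
Variables (A : pzRingType) (r : int -> nat) (D : forall i j, 'M[A]_(r i, r j)).
Hypothesis Dshape : forall i j, j != i + 1 -> D i j = 0.
Hypothesis DD : forall i j k, D i j *m D j k = 0.

Lemma mx_cd_shape i j (x : 'rV_(r i)) : j != i + 1 -> mulmxr (D i j) x = 0.
Proof. by move=> /Dshape D0; rewrite /= D0 mulmx0. Qed.

Lemma mx_cd_cd i j k (x : 'rV_(r i)) : mulmxr (D j k) (mulmxr (D i j) x) = 0.
Proof. by rewrite /= -mulmxA DD mulmx0. Qed.

Definition mx_complex : complex A :=
  @Complex A (fun i => 'rV[A]_(r i) : lmodType A)
    (fun i j => mulmxr (D i j) : {linear _ -> _}) mx_cd_shape mx_cd_cd.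

Variables (n : int) (P : complex A) (q : chain_map mx_complex P).
Hypothesis rn : forall i, n < i -> r i = 0%N.
Hypothesis qq : quasi_iso q.

Lemma quasi_iso_cancel (Z : complex A) (z : chain_map Z mx_complex) :
  quasi_iso (cm_comp q z) -> quasi_iso z.
Proof.
move=> qz i; have [inj surj] := qz i; have [qinj _] := qq i; split=> [x xc|y yc].
  move=> /(coboundaryE _ (esym (subrK 1 i)))[y zx]; apply: inj => //.
  apply/(coboundaryE _ (esym (subrK 1 i))); exists (q (i - 1) y).
  by rewrite /= zx cm_comm.
have [|x xc /= hx] := surj (q i y); first by rewrite /cocycle -cm_comm yc linear0.
exists x => //; apply: qinj; last by rewrite linearB.
have -> : cocycle (y - z i x) <->
    cd mx_complex i (i + 1) y - cd mx_complex i (i + 1) (z i x) = 0.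
  by rewrite -linearB.
by rewrite yc -cm_comm xc linear0 subrr.
Qed.

(** The roof formed by [q] and q C represents a map P -> P[2], so q C becomes null-homotopic after
    composition with a quasi-isomorphism [z]. Freeness gives a section of [z] up to homotopy, hence
    a null-homotopy [V] of q C, and then lifts [V] through [q]. *)
Lemma mx_null_homotopic (C : forall i j, 'M[A]_(r i, r j)) :
  derived_Hom_zero (@all_complexes _) P (shift 2 P) ->
  (forall i, D i (i + 1) *m C (i + 1) (i + 1 + 2) = C i (i + 2) *m D (i + 2) (i + 1 + 2)) ->
  exists h : forall i j, 'M[A]_(r i, r j), forall i,
    C i (i + 2) = h i (i + 1) *m D (i + 1) (i + 2) + D i (i + 1) *m h (i + 1) (i + 2).
Proof.
move=> hP CD.
have qD i j (x : 'rV_(r i)) : q j (x *m D i j) = cd P i j (q i x) by exact: (cm_comm q).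
pose nm i : {linear mx_complex i -> shift 2 P i} :=
  (q (i + 2) \o mulmxr (C i (i + 2)) : {linear _ -> _}).
have nmc i j x : nm j (cd mx_complex i j x) = cd (shift 2 P) i j (nm i x).
  have [->|ji] := eqVneq j (i + 1); last by rewrite !cd_shape // linear0.
  by rewrite /= /shift_d mulr1z -mulmxA CD mulmxA qD.
have [Z [z [w [_ /= qz _ [k hk]]]]] := hP (Roof qq (ChainMap nmc)) I.
have zq := quasi_iso_cancel qz.
(* With u = 0 and v the identity, [s] is a section of [z] up to the homotopy [t]. [pid_mx] is the
   identity for j = i and is well typed for all j. *)
have [||s [t hst]] := @lift_to_cone A Z mx_complex z zq r n 0 rn D DD
  (fun i j => (\0 : {linear 'rV[A]_(r i) -> Z j}))
  (fun i j => (mulmxr (pid_mx (r i)) : {linear 'rV[A]_(r i) -> mx_complex j})).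
- by move=> *; rewrite linear0 oppr0.
- by move=> i j x -> /=; rewrite addr0 linear0 !pid_mx_1 !mulmx1 subrr.
have sD i x : cd Z i (i + 1) (s i i x) = s (i + 1) (i + 1) (x *m D i (i + 1)).
  have [/eqP + _] := hst i i x (esym (addr0 i)).
  by rewrite /= eq_sym subr_eq0 => /eqP.
have zs i x : x =
    z i (s i i x) + t i (i - 1) x *m D (i - 1) i + t (i + 1) i (x *m D i (i + 1)).
  by have [_] := hst i i x (esym (addr0 i)); rewrite /= pid_mx_1 mulmx1.
have V_ex i : exists V : forall j, {linear 'rV[A]_(r i) -> P j}, forall x,
    V (i - 1 + 2) x = k i (i - 1) (s i i x) +
      q (i - 1 + 2) (t i (i - 1) x *m C (i - 1) (i - 1 + 2)).
  pose f : {linear 'rV[A]_(r i) -> P (i - 1 + 2)} :=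
    (k i (i - 1) \o s i i) \+
    (q (i - 1 + 2) \o (mulmxr (C (i - 1) (i - 1 + 2)) \o t i (i - 1))).
  have [V [VE _]] := dep_extend (B := fun j => {linear 'rV[A]_(r i) -> P j})
    (fun j => \0) f.
  by exists V => x; rewrite VE.
have [V hV] : exists V : forall i j, {linear 'rV[A]_(r i) -> P j}, forall i x,
    V i (i - 1 + 2) x = k i (i - 1) (s i i x) +
      q (i - 1 + 2) (t i (i - 1) x *m C (i - 1) (i - 1 + 2)).
  exists (fun i => sval (cid (V_ex i))) => i x; exact: (svalP (cid (V_ex i))).
have qC i x : q (i + 2) (x *m C i (i + 2)) =
    cd P (i - 1 + 2) (i + 2) (V i (i - 1 + 2) x) + V (i + 1) (i + 2) (x *m D i (i + 1)).
  have hV1 := hV (i + 1) (x *m D i (i + 1)); rewrite addrK in hV1; rewrite {}hV1 hV.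
  have := hk i (s i i x); rewrite /= subr0 /shift_d mulr1z sD => hkx.
  rewrite {1}[x]zs !mulmxDl !linearD /= hkx.
  have := CD (i - 1); rewrite subrK => CD1.
  by rewrite -[_ *m D _ _ *m C _ _]mulmxA CD1 mulmxA qD -[LHS]addrA; exact: addrACA.
(* Using -D absorbs the sign in the condition on u, since [C] commutes with [D]. *)
have [|||s' [t' hst']] := @lift_to_cone A mx_complex P q qq r n 1 rn (fun i j => - D i j) _
  (fun i j => (mulmxr (C i j) : {linear 'rV[A]_(r i) -> mx_complex j})) V.
- by move=> i j l; rewrite mulNmx mulmxN opprK DD.
- move=> i j x ->; have -> : i + 1 + 1 = i + 2 by rewrite -addrA.
  have -> : i + 2 + 1 = i + 1 + 2 by rewrite addrAC.
  by rewrite /= mulmxN mulNmx opprK -!mulmxA CD.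
- move=> i j x ->; have -> : i + 1 + 1 = i + 2 by rewrite -addrA.
  have := qC i x; have -> : i - 1 + 2 = i + 1 by rewrite -addrA.
  by rewrite /= mulmxN linearN opprK.
exists (fun i j => lin1_mx (s' i j)) => i; apply: rV_mul_inj => x.
have [+ _] := hst' i (i + 1) x erefl.
have -> : i + 1 + 1 = i + 2 by rewrite -addrA.
by rewrite mulmxDr !mulmxA !mul_rV_lin1 /= mulmxN linearN opprK.
Qed.

End MatrixComplex.

(** * Resolutions by finitely generated free modules *)

Section Resolution.
Variables (A : pzRingType) (P : complex A).
Hypothesis hA : noeth_ring A.

(* A free module with a map to each P i, only one of which is meaningful, and *)
(* the submodule of its cycles.                                               *)
Let state := {k : nat &
  ((forall i, {linear 'rV[A]_k -> P i}) * ('rV[A]_k -> Prop))%type}.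
Local Notation q t := (projT2 t).1.
Local Notation Z t := (projT2 t).2.

(** [t'] maps onto the fibre product of [Z t] and [P i] over [P (i + 1)]. This surjectivity, the
    last clause, yields both halves of the quasi-isomorphism. *)
Let covers (i : int) (t t' : state) (d : 'M[A]_(projT1 t', projT1 t)) :=
  [/\ forall x, Z t' x <-> x *m d = 0, forall x, Z t (x *m d),
      forall x, q t (i + 1) (x *m d) = cd P i (i + 1) (q t' i x) &
      forall z p, Z t z -> q t (i + 1) z = cd P i (i + 1) p ->
        exists x, x *m d = z /\ q t' i x = p].

(** The fibre product [W] is finitely generated, being a submodule of a finitely generated module
    over a Noetherian ring. *)
Lemma covers_exist i (t : state) : fin_gen (P i) -> is_submod (Z t) ->
  exists t', is_submod (Z t') /\ exists d, @covers i t t' d.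
Proof.
move=> hP hZ; pose W (w : 'rV[A]_(projT1 t) * P i) :=
  Z t w.1 /\ q t (i + 1) w.1 = cd P i (i + 1) w.2.
have hW : is_submod W.
  split; first by split; rewrite ?linear0 //; apply: (submod0 hZ).
  move=> c [z p] [z' p'] [/= h1 h2] [/= h3 h4]; split=> /=; first exact: submodP.
  by rewrite !linearP h2 h4.
have [s sW Ws] := fin_gen_noeth hA (fin_gen_prod (row_fin_gen _ _) hP) hW.
pose f := row_comb (fun j : 'I_(size s) => s`_j).
have fW x : W (f x).
  by apply: (submod_sum _ hW) => j _; apply: submodZ => //; apply: sW; apply: mem_nth.
have Wf w : W w -> exists x, f x = w.
  move=> /Ws[c ->]; exists (\row_j c j); apply: eq_bigr => j _.
  by rewrite mxE.
have [q' [q'E _]] := dep_extend (B := fun i => {linear 'rV[A]_(size s) -> P i})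
  (fun i => \0) (snd \o f : {linear _ -> _}).
pose d := lin1_mx (fst \o f : {linear _ -> _}).
have dE x : x *m d = (f x).1 by rewrite mul_rV_lin1.
exists (existT _ (size s) (q', fun x => x *m d = 0)); split.
  split=> [|c x y /= h1 h2]; first by rewrite /= mul0mx.
  by rewrite /= mulmxDl -scalemxAl h1 h2 scaler0 addr0.
exists d; split=> //= [x|x|z p hz hqz].
- by rewrite dE; case: (fW x).
- by rewrite /= q'E dE; case: (fW x).
have [|x fx] := Wf (z, p); first by split.
by exists x; rewrite /= q'E dE /= fx.
Qed.

Lemma mx_resolution : Dminus_mod P ->
  exists (r : int -> nat) (D : forall i j, 'M[A]_(r i, r j))
    (Dshape : forall i j, j != i + 1 -> D i j = 0)
    (DD : forall i j k, D i j *m D j k = 0)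
    (q : chain_map (mx_complex Dshape DD) P),
    (exists n : int, forall i, n < i -> r i = 0%N) /\ quasi_iso q.
Proof.
move=> [[n hn] hfg].
pose t0 : state := existT _ 0%N (fun i => (\0 : {linear 'rV[A]_0 -> P i}), fun=> True).
pose Rel i t t' := (n < i -> projT1 t' = 0%N) /\ exists d, @covers i t t' d.
have [i ni|i t ni ht|f hf] := @int_down_choice state (fun _ t => is_submod (Z t)) Rel t0 n.
- split; first by split.
  split=> //; exists 0; split=> //= [x|x|z p _ _].
  + by split=> // _; rewrite mulmx0.
  + by rewrite [RHS](hn (i + 1)) ?[LHS](hn (i + 1)) // ltr_wpDr.
  + by exists 0; rewrite mulmx0 [z]thinmx0 [p]hn.
- have [t' [ht' hd]] := covers_exist (hfg i) ht; exists t'; split=> //.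
  by split=> //; rewrite ltNge ni.
pose r i := projT1 (f i).
have fn i : n < i -> r i = 0%N by case: (hf i).
pose d i : 'M[A]_(r i, r (i + 1)) := sval (cid (hf i).2).
have dP i : @covers i (f (i + 1)) (f i) (d i) := svalP (cid (hf i).2).
have D_ex i : exists D : forall j, 'M[A]_(r i, r j),
    D (i + 1) = d i /\ forall j, j <> i + 1 -> D j = 0.
  exact: (dep_extend (B := fun j => 'M[A]_(r i, r j)) (fun j => 0)).
pose D i := sval (cid (D_ex i)).
have [Dd D0] : (forall i, D i (i + 1) = d i) /\ forall i j, j <> i + 1 -> D i j = 0.
  by split=> i; case: (svalP (cid (D_ex i))).
have Dshape i j : j != i + 1 -> D i j = 0 by move/eqP; apply: D0.
have DD i j k : D i j *m D j k = 0.
  have [->|/Dshape ->] := eqVneq j (i + 1); last by rewrite mul0mx.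
  have [->|/Dshape ->] := eqVneq k (i + 1 + 1); last by rewrite mulmx0.
  rewrite !Dd; apply: rV_mul_inj => x; rewrite mulmx0 mulmxA.
  by have [_ h _ _] := dP i; have [h' _ _ _] := dP (i + 1); apply/h'.
have qc i j (x : mx_complex Dshape DD i) :
    q (f j) j (cd (mx_complex Dshape DD) i j x) = cd P i j (q (f i) i x).
  have [->|ji] := eqVneq j (i + 1); last by rewrite !cd_shape // linear0.
  by have [_ _ h _] := dP i; rewrite -h /= Dd.
exists r, D, Dshape, DD, (ChainMap qc); split; first by exists n.
move=> i; split=> [|y yc].
  have e : i = i - 1 + 1 by rewrite subrK.
  move: (i - 1) e => j -> x xc /(coboundaryE _ (erefl (j + 1)))[p qx].
  apply/(coboundaryE _ (erefl (j + 1))).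
  have [_ _ _ h] := dP j; have [h' _ _ _] := dP (j + 1).
  have [|y [yx _]] := h x p _ qx; first by apply/h'; rewrite -Dd.
  by exists y; rewrite /= Dd yx.
have [_ _ _ h] := dP i; have [Z0 _ _ _] := dP (i + 1).
(* A cocycle [y] pairs with z = 0 in the fibre product, so it is the image of a cycle. *)
have [||x [xd xy]] := h 0 y; first by apply/Z0; rewrite mul0mx.
  by rewrite linear0 yc.
exists x; first by rewrite /cocycle /= Dd.
by exists 0; rewrite linear0 /= xy subrr.
Qed.

End Resolution.

(** * Lifting differentials *)

Section AlgebraFiltration.
Variables (R : comPzRingType) (a : ideal R) (Lam : algebra R).

Definition conv_proj (x : Lam^c) : (quotring (ideal_ext a Lam))^c :=
  qproj (ideal_ext a Lam) (x : Lam).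

Lemma conv_proj_zmod : zmod_morphism conv_proj.
Proof. by move=> x y; rewrite /conv_proj; exact: (raddfB (qproj (ideal_ext a Lam))). Qed.
HB.instance Definition _ := GRing.isZmodMorphism.Build Lam^c
  (quotring (ideal_ext a Lam))^c conv_proj conv_proj_zmod.

Lemma conv_proj_monoid : monoid_morphism conv_proj.
Proof.
split=> [|x y]; first exact: (rmorph1 (qproj (ideal_ext a Lam))).
exact: (rmorphM (qproj (ideal_ext a Lam))).
Qed.
HB.instance Definition _ := GRing.isMonoidMorphism.Build Lam^c
  (quotring (ideal_ext a Lam))^c conv_proj conv_proj_monoid.

Definition in_filt n (x : Lam^c) := in_IM (ideal_pow a n) (x : alg_module Lam).

Lemma in_filtD n x y : in_filt n x -> in_filt n y -> in_filt n (x + y).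
Proof. exact: (submodD (IM_submod _)). Qed.

Lemma in_filtN n x : in_filt n x -> in_filt n (- x).
Proof. exact: (submodN (IM_submod _)). Qed.

Lemma in_filtM m n x y : in_filt m x -> in_filt n y -> in_filt (m + n) (x * y).
Proof.
move=> hx hy; have mulsubl (v : alg_module Lam) k :
    is_submod (fun u : alg_module Lam => in_filt k ((u : Lam^c) * (v : Lam^c))).
  split; first by rewrite mul0r; exact: (submod0 (IM_submod _)).
  move=> c u w hu hw; rewrite mulrDl; apply: in_filtD => //.
  rewrite /in_filt -[X in in_IM _ X]/((v : Lam) * (alg_map Lam c * (u : Lam))).
  by rewrite mulrA -alg_central -mulrA; exact: (submodZ c (IM_submod _)).
have mulsubr (v : alg_module Lam) k :
    is_submod (fun u : alg_module Lam => in_filt k ((v : Lam^c) * (u : Lam^c))).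
  split; first by rewrite mulr0; exact: (submod0 (IM_submod _)).
  move=> c u w hu hw; rewrite mulrDr; apply: in_filtD => //.
  rewrite /in_filt -[X in in_IM _ X]/((alg_map Lam c * (u : Lam)) * (v : Lam)).
  by rewrite -mulrA; exact: (submodZ c (IM_submod _)).
apply: (IM_min (mulsubl y _) _ hx) => c u cm.
apply: (IM_min (mulsubr _ _) _ hy) => d w dn.
rewrite /in_filt -[X in in_IM _ X]/((alg_map Lam d * (w : Lam)) * (alg_map Lam c * (u : Lam))).
rewrite mulrA -(mulrA _ _ (alg_map Lam c)) -alg_central (mulrA _ (alg_map Lam c)) -rmorphM.
by rewrite -!mulrA; apply: IM_scale; rewrite mulrC; apply: ideal_powD_mem.
Qed.

Lemma in_filt_le m n x : (m <= n)%N -> in_filt n x -> in_filt m x.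
Proof. by move=> mn; apply: IM_sub; apply: ideal_pow_le. Qed.

Lemma conv_proj_eq0 x : conv_proj x = 0 <-> in_filt 1 x.
Proof.
have -> : conv_proj x = 0 <-> (x : Lam) \in ideal_mem (ideal_ext a Lam).
  by rewrite -[0](raddf0 (qproj (ideal_ext a Lam))) qproj_eq subr0.
split=> [/asboolP h|h].
  by apply: (@IM_sub R (alg_module Lam) a _ x _ h) => y; rewrite ideal_pow1.
by apply/asboolP; apply: (@IM_sub R (alg_module Lam) _ a x _ h) => y; rewrite ideal_pow1.
Qed.

Definition conv_scalar (c : R) : Lam^c := alg_map Lam c.

Lemma conv_scalar_central c (x : Lam^c) : conv_scalar c * x = x * conv_scalar c.
Proof. exact/esym/alg_central. Qed.

Lemma conv_scalarE c (x : Lam^c) :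
  conv_scalar c * x = (c *: (x : alg_module Lam) : alg_module Lam).
Proof. by rewrite conv_scalar_central. Qed.

Definition mx_filt n p q (M : 'M[Lam^c]_(p, q)) := forall i j, in_filt n (M i j).

Section MatrixFiltration.
Variables p q : nat.
Implicit Types M N : 'M[Lam^c]_(p, q).

Lemma mx_filtD n M N : mx_filt n M -> mx_filt n N -> mx_filt n (M + N).
Proof. by move=> hM hN i j; rewrite mxE; apply: in_filtD. Qed.

Lemma mx_filtN n M : mx_filt n M -> mx_filt n (- M).
Proof. by move=> hM i j; rewrite mxE; apply: in_filtN. Qed.

Lemma mx_filtB n M N : mx_filt n M -> mx_filt n N -> mx_filt n (M - N).
Proof. by move=> hM hN; apply: mx_filtD => //; apply: mx_filtN. Qed.

Lemma mx_filt0 n : mx_filt n (0 : 'M[Lam^c]_(p, q)).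
Proof. by move=> i j; rewrite mxE; exact: (submod0 (IM_submod _)). Qed.

Lemma mx_filt_sum n (I : finType) (F : I -> 'M[Lam^c]_(p, q)) :
  (forall l, mx_filt n (F l)) -> mx_filt n (\sum_l F l).
Proof. by move=> h; elim/big_ind: _ => //; [exact: mx_filt0|exact: mx_filtD]. Qed.

Lemma mx_filtM n1 n2 s M (N : 'M[Lam^c]_(q, s)) :
  mx_filt n1 M -> mx_filt n2 N -> mx_filt (n1 + n2) (M *m N).
Proof.
move=> hM hN i j; rewrite mxE; apply: (submod_sum _ (IM_submod _)) => l _.
exact: in_filtM.
Qed.

Lemma mx_filt_top M : mx_filt 0 M.
Proof. by move=> i j; apply: IM_full. Qed.

Lemma mx_filtMl n s M (N : 'M[Lam^c]_(q, s)) : mx_filt n N -> mx_filt n (M *m N).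
Proof. exact: (mx_filtM (mx_filt_top M)). Qed.

Lemma mx_filtMr n s M (N : 'M[Lam^c]_(q, s)) : mx_filt n M -> mx_filt n (M *m N).
Proof.
move=> hM; rewrite -[n]addn0; apply: mx_filtM => // i j; exact: IM_full.
Qed.

Lemma mx_filt_le m n M : (m <= n)%N -> mx_filt n M -> mx_filt m M.
Proof. by move=> mn h i j; apply: in_filt_le (h i j). Qed.

Lemma mx_filt_scale n m c M : c \in ideal_mem (ideal_pow a n) -> mx_filt m M ->
  mx_filt (n + m) (conv_scalar c *: M).
Proof.
move=> cn hM i j; rewrite mxE; apply: in_filtM => //.
rewrite /in_filt -[conv_scalar c]mulr1 conv_scalarE.
exact: IM_scale.
Qed.

Lemma map_conv_proj_eq0 M : map_mx conv_proj M = 0 <-> mx_filt 1 M.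
Proof.
split=> [h i j|h]; last by apply/matrixP => i j; rewrite !mxE; apply/conv_proj_eq0.
by apply/conv_proj_eq0; have /matrixP/(_ i j) := h; rewrite !mxE.
Qed.

Lemma map_conv_proj_lift (M : 'M[(quotring (ideal_ext a Lam))^c]_(p, q)) :
  exists M' : 'M[Lam^c]_(p, q), map_mx conv_proj M' = M.
Proof.
exists (map_mx (fun x : (quotring (ideal_ext a Lam))^c =>
  (qrepr (x : quotring (ideal_ext a Lam)) : Lam) : Lam^c) M).
apply/matrixP => i j; rewrite !mxE.
exact: qreprK.
Qed.

Lemma mulmx_conv_scalar s M c (N : 'M[Lam^c]_(q, s)) :
  M *m (conv_scalar c *: N) = conv_scalar c *: (M *m N).
Proof.
apply/matrixP => i j; rewrite !mxE mulr_sumr; apply: eq_bigr => l _.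
by rewrite mxE !mulrA conv_scalar_central.
Qed.

Lemma mx_filt_generates n k (x : 'I_k -> R) M : gr_generates a n x -> mx_filt n M ->
  exists C : 'I_k -> 'M[Lam^c]_(p, q), mx_filt n.+1 (M - \sum_l conv_scalar (x l) *: C l).
Proof.
move=> gen hM.
have /choice[c hc] (ij : 'I_p * 'I_q) := IM_gr_generates gen (hM ij.1 ij.2).
exists (fun l => \matrix_(i, j) c (i, j) l) => i j.
rewrite !mxE summxE; have := hc (i, j).
rewrite /in_filt /=; congr (in_IM _ (_ - _)); apply: eq_bigr => l _.
by rewrite !mxE conv_scalarE.
Qed.

Lemma mx_filt_indep n k (x : 'I_k -> R) (C : 'I_k -> 'M[Lam^c]_(p, q)) :
  (forall l : 'I_k -> alg_module Lam, in_IM (ideal_pow a n.+1) (\sum_j x j *: l j) ->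
    forall j, in_IM a (l j)) ->
  mx_filt n.+1 (\sum_l conv_scalar (x l) *: C l) -> forall l, mx_filt 1 (C l).
Proof.
move=> indep h l i j; rewrite /in_filt.
apply: (IM_sub (I := a)) => [y|]; first by rewrite ideal_pow1.
apply: (indep (fun l => C l i j : alg_module Lam)).
have := h i j; rewrite summxE /in_filt; congr (in_IM _ _); apply: eq_bigr => m _.
by rewrite mxE conv_scalarE.
Qed.

End MatrixFiltration.
End AlgebraFiltration.

Lemma mulmxB_comm (A : pzRingType) p q s t (M : 'M[A]_(p, q)) (N : 'M[A]_(s, t))
    (E0 S0 : 'M[A]_(p, s)) (E1 S1 : 'M[A]_(q, t)) : M *m E1 = E0 *m N ->
  (E0 - S0) *m N - M *m (E1 - S1) = M *m S1 - S0 *m N.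
Proof. by move=> e; rewrite mulmxBl mulmxBr e opprB addrC addrA subrK. Qed.

Lemma mulmx_telescope (A : pzRingType) p q s (M N : 'M[A]_(p, q)) (M' N' : 'M[A]_(q, s)) :
  M *m M' = N *m N' + (N *m (M' - N') + (M - N) *m M').
Proof. by rewrite mulmxBr mulmxBl addrA [X in X + _]addrC subrK addrC subrK. Qed.

Section LiftDifferential.
Variables (R : comPzRingType) (a : ideal R) (Lam : algebra R).
Hypothesis basis : forall n, (0 < n)%N -> exists k (x : 'I_k -> R), gr_generates a n x /\
  forall l : 'I_k -> alg_module Lam, in_IM (ideal_pow a n.+1) (\sum_j x j *: l j) ->
    forall j, in_IM a (l j).
Hypothesis complete : forall u : nat -> alg_module Lam,
  (forall n, in_IM (ideal_pow a n) (u n.+1 - u n)) ->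
  exists x, forall n, in_IM (ideal_pow a n) (x - u n).
Hypothesis separated : forall x : alg_module Lam,
  (forall n, in_IM (ideal_pow a n) x) -> x = 0.

Variables (r : int -> nat).
Let fam := forall i j, 'M[Lam^c]_(r i, r j).
Variable d : forall i j, 'M[(quotring (ideal_ext a Lam))^c]_(r i, r j).
Hypothesis null_homotopic : forall C : forall i, 'M_(r i, r (i + 2)),
  (forall i, d i (i + 1) *m C (i + 1) = C i *m d (i + 2) (i + 1 + 2)) ->
  exists h : forall i j, 'M_(r i, r j), forall i,
    C i = h i (i + 1) *m d (i + 1) (i + 2) + d i (i + 1) *m h (i + 1) (i + 2).

Local Notation proj := (map_mx (@conv_proj _ a Lam)).

Definition square_filt n (D : fam) := forall i,
  mx_filt a n (D i (i + 1) *m D (i + 1) (i + 2)).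

Definition lifts (D : fam) := forall i j, proj (D i j) = d i j.

Lemma lift_step n (D : fam) : (0 < n)%N -> lifts D -> square_filt n D ->
  exists D' : fam, (forall i j, mx_filt a n (D' i j - D i j)) /\ square_filt n.+1 D'.
Proof.
move=> n0 Dd Dn; have [k [x [gen indep]]] := basis n0; have [xn _] := gen.
pose E i := D i (i + 1) *m D (i + 1) (i + 2).
have C_ex i : exists C : 'I_k -> 'M[Lam^c]_(r i, r (i + 2)),
  mx_filt a n.+1 (E i - \sum_l conv_scalar Lam (x l) *: C l) := mx_filt_generates gen (Dn i).
pose C i := sval (cid (C_ex i)).
have hC i : mx_filt a n.+1 (E i - \sum_l conv_scalar Lam (x l) *: C i l) :=
  svalP (cid (C_ex i)).
(* Associativity of D D D; by independence of the [x l], it makes each [C i l] commute with the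
   differential modulo a. *)
have DE i : D i (i + 1) *m E (i + 1) = E i *m D (i + 2) (i + 1 + 2).
  have e : i + 1 + 1 = i + 2 by rewrite -addrA.
  by rewrite /E e mulmxA.
have comm l i : d i (i + 1) *m map_mx (@conv_proj _ a Lam) (C (i + 1) l) =
    map_mx (@conv_proj _ a Lam) (C i l) *m d (i + 2) (i + 1 + 2).
  rewrite -!Dd -!map_mxM; apply/eqP; rewrite -subr_eq0 -map_mxB; apply/eqP.
  apply/map_conv_proj_eq0; move: l; apply: (mx_filt_indep indep).
  set e := fun i => E i - \sum_l conv_scalar Lam (x l) *: C i l.
  rewrite [X in mx_filt _ _ X](_ : _ =
    e i *m D (i + 2) (i + 1 + 2) - D i (i + 1) *m e (i + 1)).
    by apply: mx_filtB; [apply: mx_filtMr|apply: mx_filtMl].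
  rewrite (mulmxB_comm _ _ (DE i)) mulmx_sumr mulmx_suml -sumrB.
  by apply: eq_bigr => l _; rewrite mulmx_conv_scalar -scalemxAl scalerBr.
have h_ex l := null_homotopic (comm l).
pose h l := sval (cid (h_ex l)).
have hh l i : _ = _ := svalP (cid (h_ex l)) i.
have H_ex l i j := map_conv_proj_lift (h l i j).
pose H l i j := sval (cid (H_ex l i j)).
have HE l i j : map_mx (@conv_proj _ a Lam) (H l i j) = h l i j := svalP (cid (H_ex l i j)).
pose S i j := \sum_l conv_scalar Lam (x l) *: H l i j.
have Sn i j : mx_filt a n (S i j).
  apply: mx_filt_sum => l; rewrite -[n]addn0; apply: mx_filt_scale => //.
  exact: mx_filt_top.
exists (fun i j => D i j - S i j); split=> [i j|i].
  by rewrite addrAC subrr add0r; apply: mx_filtN.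
rewrite mulmxBl !mulmxBr -/(E i).
have -> : forall p q (M N N' N'' : 'M[Lam^c]_(p, q)), M - N - (N' - N'') = M - (N + N') + N''.
  by move=> p q M N N' N''; rewrite opprB opprD !addrA addrAC.
(* The quadratic term S S lies in a^(2n), hence in a^(n+1) as n > 0. *)
apply: mx_filtD; last first.
  apply: (@mx_filt_le _ _ _ _ _ _ (n + n)); last exact: mx_filtM.
  by rewrite -addn1 leq_add2l.
rewrite -(subrKA (\sum_l conv_scalar Lam (x l) *: C i l)).
apply: mx_filtD; first exact: (hC i).
rewrite mulmx_sumr mulmx_suml -big_split -sumrB.
apply: mx_filt_sum => l; rewrite /= mulmx_conv_scalar -scalemxAl -scalerDr -scalerBr.
rewrite -[n.+1]addn1; apply: mx_filt_scale => //; apply/map_conv_proj_eq0.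
rewrite map_mxB map_mxD !map_mxM !HE !Dd.
have := hh l i; rewrite -/(h l) => ->.
by apply/eqP; rewrite subr_eq0; apply/eqP; exact: addrC.
Qed.

Lemma lift_differential : (forall i j k, d i j *m d j k = 0) ->
  exists D : fam, [/\ lifts D & forall i, D i (i + 1) *m D (i + 1) (i + 2) = 0].
Proof.
move=> dd; have D0_ex i j := map_conv_proj_lift (d i j).
pose D0 i j := sval (cid (D0_ex i j)).
have D0d : lifts D0 by move=> i j; exact: (svalP (cid (D0_ex i j))).
pose good n D := lifts D /\ square_filt n D.
have good1 : good 1%N D0.
  by split=> // i; apply/map_conv_proj_eq0; rewrite map_mxM !D0d dd.
have next_ex (nD : nat * fam) : exists D', good nD.1.+1 nD.2 ->
    (forall i j, mx_filt a nD.1.+1 (D' i j - nD.2 i j)) /\ good nD.1.+2 D'.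
  have [[h1 h2]|h] := pselect (good nD.1.+1 nD.2); last by exists D0.
  have [D' [h3 h4]] := lift_step (ltn0Sn nD.1) h1 h2.
  exists D' => _; split=> //; split=> // i j.
  apply/eqP; rewrite -subr_eq0 -h1 -map_mxB; apply/eqP/map_conv_proj_eq0.
  by apply: mx_filt_le (h3 i j).
have [next hnext] := choice next_ex.
(* [F n] squares to zero modulo a^(n+1): the start at exponent 1 is the identity d d = 0 over the
   quotient. *)
pose fix F n := if n is n'.+1 then next (n', F n') else D0.
have Fgood n : good n.+1 (F n).
  by elim: n => [|n IH]; [exact: good1|case: (hnext (n, F n) IH)].
have Fn n i j : mx_filt a n.+1 (F n.+1 i j - F n i j).
  by case: (hnext (n, F n) (Fgood n)).
have L_ex i j : exists L : 'M[Lam^c]_(r i, r j), forall n, mx_filt a n (L - F n i j).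
  have lim (uv : 'I_(r i) * 'I_(r j)) : exists y : alg_module Lam,
      forall n, in_IM (ideal_pow a n) (y - (F n i j uv.1 uv.2 : alg_module Lam)).
    apply: (complete (u := fun n => F n i j uv.1 uv.2)) => n.
    have := @in_filt_le _ _ _ n _ _ (leqnSn n) (Fn n i j uv.1 uv.2).
    by rewrite !mxE.
  have [y hy] := choice lim; exists (\matrix_(u, v) y (u, v)) => n u v.
  by rewrite !mxE; exact: (hy (u, v) n).
pose L i j := sval (cid (L_ex i j)).
have LF i j n : mx_filt a n (L i j - F n i j) := svalP (cid (L_ex i j)) n.
exists L; split=> [i j|i].
  have [+ _] := Fgood 1%N => /(_ i j) <-.
  apply/eqP; rewrite -subr_eq0 -map_mxB; apply/eqP/map_conv_proj_eq0.
  exact: LF.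
apply/matrixP => u v; rewrite [RHS]mxE; apply: separated => n.
move: u v; suff h : mx_filt a n (L i (i + 1) *m L (i + 1) (i + 2)) by exact: h.
rewrite (mulmx_telescope _ (F n i (i + 1)) _ (F n (i + 1) (i + 2))).
apply: mx_filtD; last apply: mx_filtD.
- by have [_ h] := Fgood n; apply: mx_filt_le (h i).
- exact: mx_filtMl.
- exact: mx_filtMr.
Qed.

End LiftDifferential.

(** * Base change to the quotient algebra *)

Section QuotientAlgebra.
Variables (R : comPzRingType) (a : ideal R) (Lam : algebra R).

(** A one-sided ideal pulls back to an R-submodule of [Lam], and the images of R-generators of the
    latter generate it. *)
Lemma quotient_noeth_ring : noetherian R -> fin_gen (alg_module Lam : lmodType R) ->
  noeth_ring (quotring (ideal_ext a Lam))^c.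
Proof.
move=> /noetherian_noeth_ring hR hLam U hU.
pose pr (x : alg_module Lam) : ((quotring (ideal_ext a Lam))^c)^o := conv_proj a (x : Lam^c).
have preim (W : ((quotring (ideal_ext a Lam))^c)^o -> Prop) :
    is_submod W -> is_submod (fun x => W (pr x)).
  move=> hW; split.
    by rewrite /pr [conv_proj _ _](raddf0 (conv_proj a (Lam := Lam))); exact: (submod0 hW).
  move=> c x y Wx Wy.
  have -> : pr (c *: x + y) = (conv_proj a (conv_scalar Lam c)) *: pr x + pr y.
    rewrite /pr [LHS](raddfD (conv_proj a (Lam := Lam))); congr (_ + _).
    by rewrite -[c *: x]conv_scalarE [LHS]rmorphM.
  exact: submodP.
have [s sU Us] := fin_gen_noeth hR hLam (preim U hU).
exists (map pr s) => [_ /mapP[x xs ->]|u Uu]; first exact: sU.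
have uE : pr (qrepr (u : quotring (ideal_ext a Lam))) = u by exact: qreprK.
rewrite -uE; rewrite -uE in Uu; move/Us: Uu.
apply: (span_min (preim _ (span_submod (map pr s)))) => x xs.
by apply: span_mem; apply: map_f.
Qed.

Local Notation phi := (qproj (ideal_ext a Lam) : {rmorphism Lam -> _}).
Local Notation Lbar := (quotring (ideal_ext a Lam)).
Variable k : nat.
Local Notation bc := (basechange phi ('rV[Lam^c]_k : lmodType Lam^c)).

Definition bc_row_pair (x : 'rV[Lam^c]_k) (b : Lbar) : 'rV[Lbar^c]_k :=
  (b : Lbar^c) *: map_mx (conv_proj a (Lam := Lam)) x.

Lemma bc_row_pair_balanced : balanced
  (fun (x : 'rV[Lam^c]_k) (c : Lam) => (c : Lam^c) *: x)
  (fun (c : Lam) (b : Lbar) => phi c * b)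
  bc_row_pair.
Proof.
split=> [x y b|x b b'|x c b]; rewrite /bc_row_pair.
- by rewrite map_mxD scalerDr.
- exact: scalerDl.
- rewrite map_mxZ scalerA; congr (_ *: _).
Qed.

Definition bc_row (t : bc) : 'rV[Lbar^c]_k := tensor_eval bc_row_pair (tensor_repr t).

Lemma bc_row_of s : bc_row (tensor_of _ _ s) = tensor_eval bc_row_pair s.
Proof. exact: tensor_repr_of bc_row_pair_balanced. Qed.

Lemma bc_row_linear : linear bc_row.
Proof.
move=> c t u; rewrite -[t]tensor_reprK -[u]tensor_reprK.
rewrite [c *: _]bc_scale_of -tensor_of_cat !bc_row_of tensor_eval_cat.
congr (_ + _); rewrite /tensor_eval big_map scaler_sumr; apply: eq_bigr => p _.
by rewrite /bc_row_pair scalerA.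
Qed.
HB.instance Definition _ :=
  GRing.isLinear.Build Lbar^c bc 'rV[Lbar^c]_k _ bc_row bc_row_linear.

(** Expanding rows in the standard basis, a balanced map sees a tensor only through its coordinates
    [bc_row t]. *)
Lemma bc_row_inj t : bc_row t = 0 -> t = 0.
Proof.
rewrite -[t]tensor_reprK bc_row_of; set s := tensor_repr t => s0.
apply/tensor_of_eq0 => G b bb.
transitivity (\sum_j b ('e_j : 'rV[Lam^c]_k) (tensor_eval bc_row_pair s 0 j)); last first.
  by rewrite s0 big1 // => j _; rewrite mxE (balanced0r bb).
rewrite /tensor_eval; under [RHS]eq_bigr do rewrite summxE (balanced_sumr bb).
rewrite exchange_big; apply: eq_bigr => p _ /=.
rewrite {1}[p.1]row_sum_delta (balanced_suml bb); apply: eq_bigr => j _.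
by have [_ _ ->] := bb; rewrite /bc_row_pair !mxE.
Qed.

Lemma bc_row_delta j : bc_row (tensor_of _ _ [:: ('e_j : 'rV[Lam^c]_k, 1 : Lbar)]) = 'e_j.
Proof.
rewrite bc_row_of /tensor_eval big_seq1 /bc_row_pair scale1r.
exact: map_delta_mx.
Qed.

Lemma bc_row_surj x : exists t, bc_row t = x.
Proof.
exists (\sum_j x 0 j *: (tensor_of _ _ [:: ('e_j : 'rV[Lam^c]_k, 1 : Lbar)] : bc)).
rewrite linear_comb [RHS]row_sum_delta; apply: eq_bigr => j _.
by congr (_ *: _); exact: bc_row_delta.
Qed.

Lemma bc_row_fin_gen : fin_gen (bc : lmodType Lbar^c).
Proof.
pose e j := tensor_of _ _ [:: ('e_j : 'rV[Lam^c]_k, 1 : Lbar)] : bc.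
exists [seq e j | j : 'I_k] => t; rewrite -/(span _ t).
have -> : t = \sum_j bc_row t 0 j *: e j.
  apply/eqP; rewrite -subr_eq0; apply/eqP; apply: bc_row_inj.
  rewrite linearB linear_comb /= {1}[bc_row t]row_sum_delta -sumrB big1 // => j _.
  by rewrite [bc_row (e j)]bc_row_delta subrr.
apply: (submod_sum _ (span_submod _)) => j _; apply: (submodZ _ (span_submod _)).
by apply: span_mem; apply: map_f; rewrite mem_enum.
Qed.

End QuotientAlgebra.

Section DerivedIso.
Variables (A : pzRingType) (X P : complex A) (f : chain_map X P).

Lemma homotopic_ext (Q S : complex A) (g h : chain_map Q S) :
  (forall i x, g i x = h i x) -> homotopic g h.
Proof.
move=> gh; exists (fun i j => (\0 : {linear Q i -> S j})) => i x.
by rewrite gh subrr /= linear0 addr0.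
Qed.

(** Both roofs have apex [X]; [f] is the numerator of one and the denominator of the other. *)
Lemma quasi_iso_derived_iso : quasi_iso f -> Dminus_mod X ->
  derived_iso (@Dminus_mod A) X P.
Proof.
move=> qf hX; exists (Roof (quasi_iso_id X) f), (Roof qf (cm_id X)); split=> //.
  exists X, (cm_id X), (cm_id X), (quasi_iso_id X); split=> //; first exact: homotopic_ext.
  exists X, (cm_id X), (cm_id X); split=> //; try exact: homotopic_ext.
  by apply: quasi_iso_comp (quasi_iso_id X); apply: quasi_iso_comp; apply: quasi_iso_id.
exists X, (cm_id X), (cm_id X), (quasi_iso_id X); split=> //; first exact: homotopic_ext.
exists X, (cm_id X), f; split=> //; try exact: homotopic_ext.
Qed.

End DerivedIso.

Lemma row0_eq0 (A : pzRingType) n (x : 'rV[A]_n) : n = 0%N -> x = 0.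
Proof. by move=> n0; subst n; apply: thinmx0. Qed.

Section MatrixComplexFacts.
Variables (A : pzRingType) (r : int -> nat) (D : forall i j, 'M[A]_(r i, r j)).
Hypothesis Dshape : forall i j, j != i + 1 -> D i j = 0.
Hypothesis DD : forall i j k, D i j *m D j k = 0.
Variable n : int.
Hypothesis rn : forall i, n < i -> r i = 0%N.

Lemma mx_complex_bounded : bounded_above (mx_complex Dshape DD).
Proof. by exists n => i /rn ri x; apply: row0_eq0. Qed.

Lemma mx_complex_Dminus : Dminus_mod (mx_complex Dshape DD).
Proof. by split=> [|i]; [exact: mx_complex_bounded|exact: row_fin_gen]. Qed.

End MatrixComplexFacts.

Section BaseChange.
Variables (R : comPzRingType) (a : ideal R) (Lam : algebra R).
Local Notation Lbar := (quotring (ideal_ext a Lam)).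
Local Notation phi := (qproj (ideal_ext a Lam) : {rmorphism Lam -> Lbar}).
Variables (r : int -> nat) (n : int).
Hypothesis rn : forall i, n < i -> r i = 0%N.
Variables (D : forall i j, 'M[Lam^c]_(r i, r j)) (d : forall i j, 'M[Lbar^c]_(r i, r j)).
Hypothesis Dshape : forall i j, j != i + 1 -> D i j = 0.
Hypothesis DD : forall i j k, D i j *m D j k = 0.
Hypothesis dshape : forall i j, j != i + 1 -> d i j = 0.
Hypothesis dd : forall i j k, d i j *m d j k = 0.
Hypothesis Dd : forall i j, map_mx (conv_proj a (Lam := Lam)) (D i j) = d i j.

Lemma bc_row_comm i j (t : bc_complex phi (mx_complex Dshape DD) i) :
  (bc_row (k := r j) :
      {linear bc_complex phi (mx_complex Dshape DD) j -> mx_complex dshape dd j})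
    (cd (bc_complex phi (mx_complex Dshape DD)) i j t) =
  cd (mx_complex dshape dd) i j (bc_row t).
Proof.
rewrite -[t]tensor_reprK /= bc_map_of !bc_row_of /tensor_eval big_map mulmx_suml.
apply: eq_bigr => p _; rewrite /bc_row_pair /= map_mxM Dd.
by rewrite scalemxAl.
Qed.

Definition bc_row_map :
    chain_map (bc_complex phi (mx_complex Dshape DD)) (mx_complex dshape dd) :=
  ChainMap bc_row_comm.

Lemma bc_row_map_qis : quasi_iso bc_row_map.
Proof.
have inj i (t u : bc_complex phi (mx_complex Dshape DD) i) :
    bc_row_map i t = bc_row_map i u -> t = u.
  move=> e; apply/eqP; rewrite -subr_eq0; apply/eqP/bc_row_inj.
  by rewrite linearB; apply/eqP; rewrite subr_eq0; apply/eqP.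
move=> i; split=> [x xc [y xy]|y yc].
  have [z zy] := bc_row_surj (Lam := Lam) (a := a) y; exists z; apply: inj.
  by rewrite cm_comm xy -zy.
have [x xy] := bc_row_surj (Lam := Lam) (a := a) y.
exists x; last by exists 0; rewrite linear0 -xy subrr.
by apply: inj; rewrite linear0 cm_comm -[bc_row_map i x]/(bc_row x) xy.
Qed.

Lemma bc_complex_Dminus : Dminus_mod (bc_complex phi (mx_complex Dshape DD)).
Proof.
split=> [|i]; last exact: bc_row_fin_gen.
by exists n => i /rn ri t; apply: bc_row_inj; apply: row0_eq0.
Qed.

(** The free complex is its own resolution, and [bc_row_map] followed by [q] compares its base
    change with [P]. *)
Lemma mx_complex_is_lift (P : complex Lbar^c) (q : chain_map (mx_complex dshape dd) P) :
  quasi_iso q -> is_lift phi P (mx_complex Dshape DD).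
Proof.
move=> qq; split; first exact: (mx_complex_Dminus _ _ rn).
exists (mx_complex Dshape DD).
  split=> [|i|]; first exact: (mx_complex_bounded _ _ rn).
    by split; [exact: row_projective|exact: row_fin_gen].
  by exists (cm_id _); apply: quasi_iso_id.
apply: (quasi_iso_derived_iso (f := cm_comp q bc_row_map)).
  exact: (quasi_iso_comp qq bc_row_map_qis).
exact: bc_complex_Dminus.
Qed.

End BaseChange.

(** * Induction on the power of the ideal, and conclusion *)

Lemma exact_mod_pow (R : comPzRingType) (M : lmodType R) (P : proj_resolution M)
    (a : ideal R) i :
  (forall n, (0 < n)%N -> exists k (x : 'I_k -> R), gr_generates a n x /\
    forall r, \sum_j r j * x j \in ideal_mem (ideal_pow a n.+1) ->
      forall j, r j \in ideal_mem a) ->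
  exact_mod P a i -> forall n, (0 < n)%N -> exact_mod P (ideal_pow a n) i.
Proof.
move=> basis ha; elim=> // -[_ _|n IH _].
  have pow1 : {subset ideal_mem (ideal_pow a 1) <= ideal_mem a}.
    by move=> y; rewrite ideal_pow1.
  move=> x /(IM_sub pow1)/ha[y hy]; exists y.
  by apply: IM_sub hy => z; rewrite ideal_pow1.
have [k [x [gen indep]]] := basis n.+1 isT.
exact: (exact_mod_powS gen indep ha (IH isT)).
Qed.

(** Adapts [mx_null_homotopic] to a [C] given only between degrees i and i + 2. *)
Lemma derived_Hom_zero_mx_null_homotopic (A : pzRingType) (r : int -> nat)
    (D : forall i j, 'M[A]_(r i, r j)) (Dshape : forall i j, j != i + 1 -> D i j = 0)
    (DD : forall i j k, D i j *m D j k = 0) (n : int) (P : complex A)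
    (q : chain_map (mx_complex Dshape DD) P) (C : forall i, 'M[A]_(r i, r (i + 2))) :
  (forall i, n < i -> r i = 0%N) -> quasi_iso q ->
  derived_Hom_zero (@all_complexes _) P (shift 2 P) ->
  (forall i, D i (i + 1) *m C (i + 1) = C i *m D (i + 2) (i + 1 + 2)) ->
  exists h : forall i j, 'M[A]_(r i, r j), forall i,
    C i = h i (i + 1) *m D (i + 1) (i + 2) + D i (i + 1) *m h (i + 1) (i + 2).
Proof.
move=> rn qq hP hC.
have fam_ex i : exists F : forall j, 'M[A]_(r i, r j), F (i + 2) = C i.
  have [F [FE _]] := dep_extend (B := fun j => 'M[A]_(r i, r j)) (fun j => 0) (C i).
  by exists F.
pose F i := sval (cid (fam_ex i)).
have FE i : F i (i + 2) = C i := svalP (cid (fam_ex i)).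
have [|h hh] := @mx_null_homotopic _ _ _ _ _ n P q rn qq F hP.
  by move=> i; rewrite !FE.
by exists h => i; rewrite -FE.
Qed.

Theorem proposition4p11 (R : comPzRingType) (a : ideal R) (Lam : algebra R)
    (hR : complete_local_ring R)
    (ha : is_proper a)
    (hLam : fin_gen (alg_module Lam : lmodType R))
    (hTor : forall i : nat, (0 < i)%N ->
       Tor_vanishes i (alg_module Lam : lmodType R) (quotring a : lmodType R))
    (hflat : normally_flat a) :
  (forall i n : nat, (0 < i)%N -> (0 < n)%N ->
     Tor_vanishes i (alg_module Lam : lmodType R)
       (quotring (ideal_pow a n) : lmodType R)) /\
  (forall P : complex (quotring (ideal_ext a Lam))^c,
     Dminus_mod P ->
     derived_Hom_zero (@all_complexes _) P (shift 2 P) ->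
     exists L : complex Lam^c,
       is_lift (qproj (ideal_ext a Lam) : {rmorphism Lam -> _}) P L).
Proof.
have [hN [m [hmax huniq hcompl]]] := hR.
have basis n (n0 : (0 < n)%N) := gr_basis_exists hN hmax huniq (hflat n n0).
split=> [[|i] n // _ n0|P hP hExt].
  (* The resolution witnessing the vanishing for R/a serves for every power of a. *)
  have [Pr hPr] := hTor i.+1 isT; exists Pr; apply/exact_modP.
  by apply: exact_mod_pow n0 => //; apply/exact_modP.
have [Pr /exact_modP hPr] := hTor 1%N isT.
have hNbar := @quotient_noeth_ring _ a _ hN hLam.
have [r [d [dshape [dd [q [[N rN] qq]]]]]] := mx_resolution hNbar hP.
have basisLam n : (0 < n)%N -> exists k (x : 'I_k -> R), gr_generates a n x /\
    forall l : 'I_k -> alg_module Lam, in_IM (ideal_pow a n.+1) (\sum_j x j *: l j) ->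
      forall j, in_IM a (l j).
  move=> n0; have [k [x [gen indep]]] := basis n n0; exists k, x; split=> // l.
  exact: (gr_indep_module gen indep hPr (exact_mod_pow basis hPr n0)).
have [D [Dd DD]] := lift_differential basisLam
  (fun u => IM_complete hN huniq ha hcompl hLam (u := u))
  (fun x => IM_separated hN hmax huniq ha hLam (x := x))
  (fun C => derived_Hom_zero_mx_null_homotopic rN qq hExt (C := C)) dd.
(* The relation D D = 0 is known only between consecutive degrees; the other lifts of zero are reset
   to zero. *)
pose D' i j := if j == i + 1 then D i j else 0.
have D'shape i j : j != i + 1 -> D' i j = 0 by rewrite /D' => /negPf ->.
have D'D' i j k : D' i j *m D' j k = 0.
  rewrite /D'; case: eqP => [->|]; last by rewrite mul0mx.
  case: eqP => [->|]; last by rewrite mulmx0.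
  by have -> : i + 1 + 1 = i + 2 by rewrite -addrA.
have D'd i j : map_mx (conv_proj a (Lam := Lam)) (D' i j) = d i j.
  rewrite /D'; case: eqP => [->|/eqP ji]; first exact: Dd.
  by rewrite (dshape _ _ ji); apply: map_mx0.
exists (mx_complex D'shape D'D').
exact: (mx_complex_is_lift rN D'shape D'D' D'd qq).
Qed.
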